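(* The $C^*$-subalgebra $C^*(u)$ is a Cartan subalgebra of $\mathcal{Q}_2$.
   Context: The 2-adic ring $C^*$-algebra $\mathcal{Q}_2$ is the universal unital $C^*$-algebra generated by a unitary $u$ and an isometry $s_2$ with $s_2u=u^2s_2$ and $s_2s_2^*+us_2s_2^*u^*=1$. Cartan is in the sense of Renault: an abelian $C^*$-subalgebra $B$ of a $C^*$-algebra $A$ is Cartan if $B$ contains an approximate unit of $A$, $B$ is maximal abelian in $A$, $B$ is regular (the set of $n\in A$ with $nBn^*\subseteq B$ and $n^*Bn\subseteq B$ generates $A$ as a $C^*$-algebra), and there is a faithful conditional expectation of $A$ onto $B$. *)

(* Defs.v *)
From HB Require Import structures.
From mathcomp Require Import all_boot all_order all_algebra.
From mathcomp Require Import complex.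
From mathcomp Require Import boolp classical_sets functions reals.
From mathcomp Require Import topology normedtype.

Set Implicit Arguments.
Unset Strict Implicit.
Unset Printing Implicit Defensive.

Import Order.TTheory GRing.Theory Num.Theory.
Import numFieldNormedType.Exports.

Local Open Scope classical_set_scope.
Local Open Scope ring_scope.

(* Unital C*-algebras over the complex field R[i]; [z^*] is complex
   conjugation.  The norm [cnorm] is real valued; it cannot be the library norm
   of a [normedModType], which has no join with [algType]. *)
HB.mixin Record isCStarAlgebra (R : realType) A of GRing.Algebra R[i] A := {
  cnorm : A -> R;
  star : A -> A;
  cnorm_eq0 : forall a : A, cnorm a = 0 -> a = 0;
  cnormD : forall a b : A, cnorm (a + b) <= cnorm a + cnorm b;
  cnormZ : forall (z : R[i]) (a : A),
    cnorm (z *: a) = Normc.normc z * cnorm a;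
  cnormM : forall a b : A, cnorm (a * b) <= cnorm a * cnorm b;
  cnorm_complete : forall x : nat -> A,
    (forall e : R, 0 < e -> exists N : nat, forall m n : nat,
       (N <= m)%N -> (N <= n)%N -> cnorm (x m - x n) < e) ->
    exists a : A, (fun n => cnorm (x n - a)) @ \oo --> (0 : R);
  starK : involutive star;
  starD : forall a b : A, star (a + b) = star a + star b;
  starZ : forall (z : R[i]) (a : A), star (z *: a) = z^* *: star a;
  starM : forall a b : A, star (a * b) = star b * star a;
  cnorm_starM : forall a : A, cnorm (star a * a) = cnorm a ^+ 2
}.

#[short(type="cstarAlgType")]
HB.structure Definition CStarAlgebra (R : realType) :=
  {A of isCStarAlgebra R A & GRing.Algebra R[i] A}.

Definition cstar_cvg (R : realType) (A : cstarAlgType R)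
    (I : Type) (F : set_system I) (x : I -> A) (a : A) : Prop :=
  (fun i => cnorm (x i - a)) @ F --> (0 : R).

Definition cstar_closed (R : realType) (A : cstarAlgType R)
    (B : set A) : Prop :=
  forall (x : nat -> A) (a : A),
    (forall n, B (x n)) -> cstar_cvg \oo x a -> B a.

(* No unit is required in a C*-subalgebra. *)
Definition cstar_subalgebra (R : realType) (A : cstarAlgType R)
    (B : set A) : Prop :=
  [/\ B 0,
      forall a b, B a -> B b -> B (a + b),
      forall (z : R[i]) a, B a -> B (z *: a),
      forall a b, B a -> B b -> B (a * b)
    & (forall a, B a -> B (star a)) /\ cstar_closed B].

Definition cstar_gen (R : realType) (A : cstarAlgType R) (S : set A) : set A :=
  smallest (@cstar_subalgebra R A) S.

Definition cstar_positive (R : realType) (A : cstarAlgType R) (a : A) : Prop :=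
  exists c : A, a = star c * c.

Definition commutative_set (R : realType) (A : cstarAlgType R)
    (B : set A) : Prop :=
  forall a b, B a -> B b -> a * b = b * a.

Definition abelian_cstar_subalgebra (R : realType) (A : cstarAlgType R)
    (B : set A) : Prop :=
  cstar_subalgebra B /\ commutative_set B.

Definition maximal_abelian (R : realType) (A : cstarAlgType R)
    (B : set A) : Prop :=
  abelian_cstar_subalgebra B /\
  forall D : set A, abelian_cstar_subalgebra D -> B `<=` D -> D = B.

Definition directed_preorder (I : Type) (le : I -> I -> Prop) : Prop :=
  [/\ inhabited I,
      forall i, le i i,
      forall i j k, le i j -> le j k -> le i k
    & forall i j, exists k, le i k /\ le j k].

Definition net_filter (I : Type) (le : I -> I -> Prop) : set_system I :=
  filter_from setT (fun i => [set j | le i j]).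

Definition approximate_unit (R : realType) (A : cstarAlgType R)
    (I : Type) (le : I -> I -> Prop) (e : I -> A) : Prop :=
  [/\ directed_preorder le,
      forall i, cstar_positive (e i) /\ cnorm (e i) <= 1,
      forall i j, le i j -> cstar_positive (e j - e i)
    & forall a : A, cstar_cvg (net_filter le) (fun i => e i * a) a /\
                    cstar_cvg (net_filter le) (fun i => a * e i) a].

Definition contains_approximate_unit (R : realType) (A : cstarAlgType R)
    (B : set A) : Prop :=
  exists (I : Type) (le : I -> I -> Prop) (e : I -> A),
    approximate_unit le e /\ forall i, B (e i).

Definition cstar_normalizer (R : realType) (A : cstarAlgType R)
    (B : set A) : set A :=
  [set n | (forall b, B b -> B (n * b * star n)) /\
           (forall b, B b -> B (star n * b * n))].

Definition cstar_regular (R : realType) (A : cstarAlgType R)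
    (B : set A) : Prop :=
  cstar_gen (cstar_normalizer B) = setT.

Definition conditional_expectation (R : realType) (A : cstarAlgType R)
    (B : set A) (E : {linear A -> A}) : Prop :=
  [/\ (forall a, B (E a)) /\ (forall b, B b -> E b = b),
      forall a, cnorm (E a) <= cnorm a,
      forall a, cstar_positive a -> cstar_positive (E a)
    & forall b a b', B b -> B b' -> E (b * a * b') = b * E a * b'].

Definition faithful_map (R : realType) (A : cstarAlgType R)
    (E : {linear A -> A}) : Prop :=
  forall a, E (star a * a) = 0 -> a = 0.

Definition cartan_subalgebra (R : realType) (A : cstarAlgType R)
    (B : set A) : Prop :=
  [/\ abelian_cstar_subalgebra B,
      contains_approximate_unit B,
      maximal_abelian B,
      cstar_regular B
    & exists E : {linear A -> A}, conditional_expectation B E /\ faithful_map E].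

Definition cstar_unitary (R : realType) (A : cstarAlgType R) (u : A) : Prop :=
  star u * u = 1 /\ u * star u = 1.

Definition cstar_isometry (R : realType) (A : cstarAlgType R) (s : A) : Prop :=
  star s * s = 1.

Definition Q2_relations (R : realType) (A : cstarAlgType R) (u s : A) : Prop :=
  [/\ cstar_unitary u,
      cstar_isometry s,
      s * u = u ^+ 2 * s
    & s * star s + u * s * star s * star u = 1].

(* (A, u, s) is a model of the 2-adic ring C*-algebra.  The morphism f is a
   unital *-homomorphism; it is unique because u and s generate A. *)
Definition is_Q2 (R : realType) (A : cstarAlgType R) (u s : A) : Prop :=
  [/\ Q2_relations u s,
      cstar_gen [set u; s] = setT
    & forall (D : cstarAlgType R) (v t : D), Q2_relations v t ->
        exists f : {lrmorphism A -> D},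
          [/\ forall a, f (star a) = star (f a), f u = v & f s = t]].

(* Main.v *)
(* Everything in Q_2 reduces to sums of words [b s^p s^*^q c] with b, c in
   B = C^*(u), since [s b = phi(b) s] and [s^* B s] is contained in B.

   Conditional expectation. The dyadic roots of unity w_i act by gauge
   automorphisms u |-> u, s |-> w_i s.  The averages
   [x |-> (x + gauge_i x) / 2], composed over all i, converge and keep exactly the
   words with p = q; on these, the averages of x and [u^(2^i) x u^-(2^i)] converge
   to a map E with values in B.  A composite of the first m two-point averages
   satisfies [2^-m |a| <= |T_m a|] for positive a, while the later averages hardly
   move a; this makes the limit faithful.

   Maximality. If y commutes with B and E y = 0, then E(y x) = 0 for every word x:
   for p <> q because [(u^(2^p) - u^(2^q)) E(y s^p s^*^q) = 0] and u has full
   spectrum, for p = q because [s^p s^*^p] averages to a scalar under conjugation by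
   powers of u.  Hence E(y y^* ) = 0 and y = 0.

   Regularity. s itself does not normalize B, but [f s] does as soon as
   f(z) f(-z) = 0, and such f, built from positive and negative parts of Re u and
   Im u, generate B as an ideal. *)

From HB Require Import structures.
Require Import Defs.
From mathcomp Require Import all_boot all_order all_algebra.
From mathcomp Require Import complex.
From mathcomp Require Import boolp classical_sets functions reals.
From mathcomp Require Import topology normedtype.
From mathcomp Require Import lra.

Set Implicit Arguments.
Unset Strict Implicit.
Unset Printing Implicit Defensive.

Import Order.TTheory GRing.Theory Num.Theory.
Import numFieldNormedType.Exports.

Local Open Scope classical_set_scope.
Local Open Scope ring_scope.

(** No spectra, characters or integrals over the circle are used. Order is reached through square
    roots: close to [1], positivity is the norm condition [cnorm (1 - a) <= 1], which passes to sums
    and limits. Dyadic roots serve twice. As gauge parameters, one of them multiplies a given word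
    with p <> q by -1, so a single average kills it exactly, and their geometric approach to 1 makes
    the late averages negligible. Moreover each root is the square of the next, and with s u = u^2 s
    this permits a recursive construction of unitaries V_n of A with V_n u = w_n u V_n. This is the
    origin of the full spectrum of [u], which enters only as: u^k b = b with k > 0 and b in B forces
    b = 0. The gauge averages have to precede the conjugations: conjugating [s] by u^(2^i) yields
    u^-(2^i) s, so the second kind of average does not settle on words with p <> q. *)

Local Notation "r *:: a" := (r%:C%C *: a) (at level 40).

(** * The norm of a C*-algebra *)

Section Norm.
Variables (R : realType) (A : cstarAlgType R).
Implicit Types (a b c x y z : A) (r t : R).

Lemma normc_real r : Normc.normc r%:C%C = `|r|.
Proof. by rewrite /= expr0n addr0 sqrtr_sqr. Qed.

Lemma cnorm0 : cnorm (0 : A) = 0.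
Proof. by rewrite -(scale0r 0) cnormZ Normc.normc0 mul0r. Qed.

Lemma cnormZr r a : cnorm (r *:: a) = `|r| * cnorm a.
Proof. by rewrite cnormZ normc_real. Qed.

Lemma cnormN a : cnorm (- a) = cnorm a.
Proof.
by rewrite -scaleN1r (_ : -1 = (-1 : R)%:C%C) ?cnormZr ?rmorphN1 // normrN1 mul1r.
Qed.

Lemma cnorm_distC a b : cnorm (a - b) = cnorm (b - a).
Proof. by rewrite -cnormN opprB. Qed.

Lemma cnorm_ge0 a : 0 <= cnorm a.
Proof. by have := cnormD a (- a); rewrite subrr cnorm0 cnormN; lra. Qed.

Lemma cnormB a b : cnorm (a - b) <= cnorm a + cnorm b.
Proof. by rewrite -(cnormN b) cnormD. Qed.

Lemma cnorm_dist_triangle b a c : cnorm (a - c) <= cnorm (a - b) + cnorm (b - c).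
Proof. by have := cnormD (a - b) (b - c); rewrite addrA subrK. Qed.

Lemma cnorm_le_dist a b : cnorm a <= cnorm b + cnorm (a - b).
Proof. by rewrite addrC -{1}(subrK b a) cnormD. Qed.

Lemma cnorm_small a : (forall e, 0 < e -> cnorm a <= e) -> a = 0.
Proof.
move=> h; apply: cnorm_eq0; apply/eqP; rewrite eq_le cnorm_ge0 andbT.
by apply/ler_addgt0Pr => e e0; rewrite add0r h.
Qed.

Lemma star0 : star (0 : A) = 0.
Proof. by rewrite -(scale0r 0) starZ rmorph0 !scale0r. Qed.

Lemma starN a : star (- a) = - star a.
Proof. by rewrite -scaleN1r starZ rmorphN1 scaleN1r. Qed.

Lemma starB a b : star (a - b) = star a - star b.
Proof. by rewrite starD starN. Qed.

Lemma star1 : star (1 : A) = 1.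
Proof. by have := starM (star 1) (1 : A); rewrite !mulr1 starK mulr1 => <-. Qed.

Lemma starZr r a : star (r *:: a) = r *:: star a.
Proof. by rewrite starZ; congr (_ *: _); apply: conjc_real. Qed.

Lemma cnorm_star a : cnorm (star a) = cnorm a.
Proof.
have le b : cnorm b <= cnorm (star b).
  have [->|b0] := eqVneq (cnorm b) 0; first exact: cnorm_ge0.
  have bp : 0 < cnorm b by rewrite lt0r b0 cnorm_ge0.
  by have := cnormM (star b) b; rewrite cnorm_starM expr2 ler_pM2r.
by apply/eqP; rewrite eq_le le andbT -{2}(starK a).
Qed.

Lemma starM_eq0 a : star a * a = 0 -> a = 0.
Proof.
move=> h; apply: cnorm_eq0; apply/eqP.
by rewrite -sqrf_eq0 -cnorm_starM h cnorm0.
Qed.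

Lemma cnorm1_le1 : cnorm (1 : A) <= 1.
Proof.
by have := cnorm_starM (1 : A); have := cnorm_ge0 (1 : A); rewrite star1 mulr1; nra.
Qed.

Lemma cnorm_le1M a b : cnorm a <= 1 -> cnorm b <= 1 -> cnorm (a * b) <= 1.
Proof.
by move=> ha hb; rewrite (le_trans (cnormM a b)) // mulr_ile1 ?cnorm_ge0.
Qed.

Lemma cnorm_isometry a : star a * a = 1 -> cnorm a <= 1.
Proof.
move=> h; have := cnorm_starM a; rewrite h => e.
by have := cnorm1_le1; have := cnorm_ge0 a; nra.
Qed.

Lemma scale_halfD a : 2^-1 *:: a + 2^-1 *:: a = a.
Proof. by rewrite -scalerDl -rmorphD -[2^-1]div1r -splitr scale1r. Qed.

Lemma cnorm_half a : cnorm (2^-1 *:: a) = 2^-1 * cnorm a.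
Proof. by rewrite cnormZr ger0_norm ?invr_ge0 ?ler0n. Qed.

(** Closedness by approximants, so that density arguments choose no sequence; [cstar_closedP] pays
    for the choice once. *)
Definition approx_closed (C : set A) : Prop :=
  forall a, (forall e, 0 < e -> exists2 b, C b & cnorm (b - a) <= e) -> C a.

Definition tends (x : nat -> A) a : Prop :=
  forall e, 0 < e -> exists N, forall n, (N <= n)%N -> cnorm (x n - a) <= e.

Lemma cstar_cvgP (x : nat -> A) a : cstar_cvg \oo x a <-> tends x a.
Proof.
split=> [/cvgrPdist_le h e /h [N _ hN]|h].
  exists N => n Nn; have := hN n Nn.
  by rewrite sub0r normrN ger0_norm ?cnorm_ge0.
apply/cvgrPdist_le => e /h [N hN]; exists N => // n /= Nn.
by rewrite sub0r normrN ger0_norm ?cnorm_ge0 ?hN.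
Qed.

Lemma cauchy_lim (x : nat -> A) :
  (forall e, 0 < e -> exists N, forall m n, (N <= n <= m)%N -> cnorm (x m - x n) <= e) ->
  exists a, tends x a.
Proof.
move=> h; suff [a /cstar_cvgP] : exists a, cstar_cvg \oo x a by exists a.
apply: cnorm_complete => e e0; have [|N hN] := h (e / 2); first by rewrite divr_gt0.
exists N => m n Nm Nn.
have [mn|/ltnW nm] := leqP m n.
  by rewrite cnorm_distC (le_lt_trans (hN _ _ _)) ?Nm //; lra.
by rewrite (le_lt_trans (hN _ _ _)) ?Nn //; lra.
Qed.

Lemma cstar_closedP (C : set A) : cstar_closed C <-> approx_closed C.
Proof.
split=> [h a ha|h x a hx /cstar_cvgP ha].
  have {}ha n : exists b, C b /\ cnorm (b - a) <= (n.+1%:R)^-1.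
    by have [|b] := ha (n.+1%:R)^-1; [rewrite invr_gt0 | exists b].
  have [x hx] := choice ha.
  apply: (h x) => [n|]; first by case: (hx n).
  apply/cstar_cvgP => e e0.
  have [N hN] : exists N : nat, e^-1 < N.+1%:R.
    exists (Num.bound e^-1); rewrite (lt_trans (archi_boundP _)) ?invr_ge0 ?ltW //.
    by rewrite ltr_nat.
  exists N => n Nn; case: (hx n) => _ /le_trans; apply.
  rewrite -[leRHS]invrK lef_pV2 ?posrE ?invr_gt0 //.
  by rewrite (le_trans (ltW hN)) // ler_nat.
by apply: h => e /ha [N /(_ N (leqnn N))]; exists (x N).
Qed.

End Norm.

(** * Square roots in the unit ball *)

Section SquareRoot.
Variables (R : realType) (A : cstarAlgType R).
Implicit Types (a b c x y z : A) (C : set A).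

(** Just what keeps the square-root iteration inside [C]. General products are left out so that the
    self-adjoint elements qualify beside commutants and unital subalgebras; a square root inherits
    all these properties. *)
Definition square_closed C : Prop :=
  [/\ C 1, forall a b, C a -> C b -> C (a - b),
      forall (r : R) a, C a -> C (r *:: a),
      forall a, C a -> C (a * a) & approx_closed C].

Definition self_adjoint a : Prop := star a = a.

Let sqrt_step x y : A := 2^-1 *:: (x + y * y).
(** The same iteration for the number 1, rising to 1. It majorizes the norms of the iterates and of
    their differences for every [x] in the unit ball. *)
Let scalar_step (y : R) : R := (1 + y * y) / 2.
Let Y n := iter n scalar_step 0.

Let Y_bounds n : 0 <= Y n <= 1.
Proof.
elim: n => [|n /andP[h0 h1]]; first by rewrite lexx ler01.
by rewrite /Y iterS -/(Y n) /scalar_step; apply/andP; split; nra.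
Qed.

(** The gap d = 1 - Y n evolves by d - d^2/2, which increases with d on [0, 1], and 2/k - 2/k^2 <=
    2/(k + 1). *)
Let Y_rate n : 1 - Y n <= 2 / n.+2%:R.
Proof.
elim: n => [|n IH]; first by rewrite subr0 divff ?pnatr_eq0.
have /andP[] := Y_bounds n; rewrite [Y n.+1]/Y iterS -/(Y n) /scalar_step.
move: IH; rewrite ler_pdivlMr // ler_pdivlMr //.
rewrite -[in n.+3%:R]addn1 natrD; have : 2 <= n.+2%:R :> R by rewrite ler_nat.
set k := n.+2%:R; set y := Y n; nra.
Qed.

Let y_bound x n : cnorm x <= 1 -> cnorm (iter n (sqrt_step x) 0) <= Y n.
Proof.
move=> x1; elim: n => [|n IH]; first by rewrite cnorm0.
rewrite /Y !iterS -/(Y n) /sqrt_step /scalar_step cnorm_half mulrC.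
rewrite ler_pM2r ?invr_gt0 // (le_trans (cnormD _ _)) // lerD //.
by rewrite (le_trans (cnormM _ _)) // ler_pM ?cnorm_ge0.
Qed.

Let y_cauchy x m n : cnorm x <= 1 -> (n <= m)%N ->
  cnorm (iter m (sqrt_step x) 0 - iter n (sqrt_step x) 0) <= Y m - Y n.
Proof.
move=> x1; elim: n m => [|n IH] m; first by rewrite !subr0 y_bound.
case: m => // m nm; rewrite /Y !iterS -/(Y n) -/(Y m) /sqrt_step /scalar_step.
set p := iter m _ 0; set q := iter n _ 0.
rewrite -scalerBr cnorm_half opprD addrACA subrr add0r.
(* This splitting needs no commutation; bounding it termwise gives (Y m)^2 - (Y n)^2. *)
have -> : p * p - q * q = p * (p - q) + (p - q) * q.
  by rewrite mulrBr mulrBl addrA subrK.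
have hpq : cnorm (p - q) <= Y m - Y n by apply: IH.
have hp : cnorm p <= Y m by apply: y_bound.
have hq : cnorm q <= Y n by apply: y_bound.
have := cnormD (p * (p - q)) ((p - q) * q).
have := cnormM p (p - q); have := cnormM (p - q) q.
have : cnorm p * cnorm (p - q) <= Y m * (Y m - Y n) by rewrite ler_pM ?cnorm_ge0.
have : cnorm (p - q) * cnorm q <= (Y m - Y n) * Y n by rewrite ler_pM ?cnorm_ge0.
lra.
Qed.

Lemma approx_lim C (x : nat -> A) a : approx_closed C -> (forall n, C (x n)) ->
  tends x a -> C a.
Proof.
move=> Ccl Cx ha; apply: Ccl => e /ha [N hN].
by exists (x N); rewrite // hN.
Qed.

Lemma square_closed0 C : square_closed C -> C 0.
Proof. by case=> C1 CB *; rewrite -(subrr 1); apply: (CB). Qed.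

Lemma square_closedD C a b : square_closed C -> C a -> C b -> C (a + b).
Proof.
move=> hC Ca Cb; have C0 := square_closed0 hC; case: hC => _ CB *.
by rewrite -(opprK b) -[- b]add0r; apply: (CB) => //; apply: (CB).
Qed.

(* The iteration y := (x + y^2) / 2 converges to 1 - sqrt (1 - x). *)
Lemma sqrt_unit_ball x : cnorm x <= 1 ->
  exists z, [/\ z * z = 1 - x, cnorm (1 - z) <= 1 &
    forall C, square_closed C -> C x -> C z].
Proof.
move=> x1; set ys := fun n => iter n (sqrt_step x) 0.
have [|y hy] := @cauchy_lim _ _ ys.
  move=> e e0; exists (Num.bound (2 / e)) => m n /andP[Nn nm].
  rewrite (le_trans (y_cauchy x1 nm)) // (@le_trans _ _ (1 - Y n)) //.
    by have := Y_bounds m; lra.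
  rewrite (le_trans (Y_rate n)) // ler_pdivrMr // -ler_pdivrMl // mulrC.
  rewrite (le_trans (ltW (archi_boundP _))) ?divr_ge0 ?(ltW e0) //.
  by rewrite ler_nat (leq_trans Nn) // -addn2 leq_addr.
have ys1 n : cnorm (ys n) <= 1.
  by rewrite (le_trans (y_bound n x1)) //; case/andP: (Y_bounds n).
have y1 : cnorm y <= 1.
  apply/ler_addgt0Pr => e /hy [N /(_ N (leqnn _))].
  by rewrite cnorm_distC; have := cnorm_le_dist y (ys N); have := ys1 N; lra.
have yE : y = 2^-1 *:: (x + y * y).
  apply/eqP; rewrite -subr_eq0; apply/eqP; apply: cnorm_small => e e0.
  have [|N hN] := hy (e / 2); first by rewrite divr_gt0.
  apply: le_trans (cnorm_dist_triangle (ys N.+1) _ _) _.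
  have := hN _ (leqnSn N); have := hN _ (leqnn N); rewrite cnorm_distC => h1 h2.
  rewrite (cnorm_distC y); apply: (@le_trans _ _ (e / 2 + e / 2)); last by lra.
  rewrite lerD // {1}/ys iterS -/(ys N) /sqrt_step -scalerBr cnorm_half.
  rewrite opprD addrACA subrr add0r.
  have -> : ys N * ys N - y * y = ys N * (ys N - y) + (ys N - y) * y.
    by rewrite mulrBr mulrBl addrA subrK.
  rewrite (cnorm_distC y) in h1.
  have := cnormD (ys N * (ys N - y)) ((ys N - y) * y).
  have := cnormM (ys N) (ys N - y); have := cnormM (ys N - y) y.
  have := ler_piMl (cnorm_ge0 (ys N - y)) (ys1 N).
  have := ler_piMr (cnorm_ge0 (ys N - y)) y1.
  lra.
exists (1 - y); split.
- have -> : x = y + y - y * y by rewrite {1 2}yE scale_halfD addrK.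
  by rewrite mulrBl mul1r mulrBr mulr1 -[y + y - _]addrA [in RHS]opprD addrA.
- by rewrite opprB addrCA subrr addr0.
move=> C hC Cx; case: (hC) => C1 CB Cr Csq Ccl; apply: (CB) => //.
apply: (approx_lim Ccl _ hy); elim=> [|n IH]; first exact: square_closed0.
by rewrite /ys iterS; apply: Cr; apply: square_closedD => //; apply: Csq.
Qed.

End SquareRoot.

(** * Positive elements *)

Section Positive.
Variables (R : realType) (A : cstarAlgType R).
Implicit Types (a b c d g h k x y z : A) (C : set A) (r t : R).

Lemma approx_closed_commutant z : approx_closed [set a : A | z * a = a * z].
Proof.
move=> a ha /=; apply/eqP; rewrite -subr_eq0; apply/eqP; apply: cnorm_small => e e0.
have Kp : 0 < 2 * (cnorm z + 1) by rewrite mulr_gt0 // ltr_wpDl ?cnorm_ge0.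
have [|b /= zb hb] := ha (e / (2 * (cnorm z + 1))); first by rewrite divr_gt0.
have -> : z * a - a * z = (b - a) * z - z * (b - a).
  by rewrite mulrBl mulrBr zb opprB [RHS]addrC addrA subrK.
rewrite (le_trans (cnormB _ _)) //.
have := cnormM (b - a) z; have := cnormM z (b - a); have := cnorm_ge0 z.
have := cnorm_ge0 (b - a).
by move: hb; rewrite ler_pdivlMr //; nra.
Qed.

Lemma square_closed_commutant z : square_closed [set a : A | z * a = a * z].
Proof.
split=> /=; first by rewrite mulr1 mul1r.
- by move=> a b ha hb; rewrite mulrBr mulrBl ha hb.
- by move=> r a ha; rewrite -scalerAr -scalerAl ha.
- by move=> a ha; rewrite mulrA ha -mulrA ha mulrA.
exact: approx_closed_commutant.
Qed.

Lemma approx_closed_self_adjoint : approx_closed [set a : A | self_adjoint a].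
Proof.
move=> a ha; apply/eqP; rewrite -subr_eq0; apply/eqP; apply: cnorm_small => e e0.
have [|b /= bsa hb] := ha (e / 2); first by rewrite divr_gt0.
rewrite (le_trans (cnorm_dist_triangle b _ _)) // -{1}bsa -starB cnorm_star.
by move: hb; rewrite cnorm_distC => hb; have := hb; rewrite cnorm_distC; lra.
Qed.

Lemma square_closed_self_adjoint : square_closed [set a : A | self_adjoint a].
Proof.
rewrite /self_adjoint; split=> /=; first exact: star1.
- by move=> a b ha hb; rewrite starB ha hb.
- by move=> r a ha; rewrite starZr ha.
- by move=> a ha; rewrite starM ha.
exact: approx_closed_self_adjoint.
Qed.

Lemma square_closed_subalgebra C : cstar_subalgebra C -> C 1 -> square_closed C.
Proof.
case=> C0 CD CZ CM [_ /cstar_closedP Ccl] C1; split=> // [a b Ca Cb|r a|a Ca].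
- by apply: CD => //; rewrite -scaleN1r; apply: CZ.
- exact: CZ.
- exact: CM.
Qed.

Lemma cnorm_sa h : self_adjoint h -> cnorm (h * h) = cnorm h ^+ 2.
Proof. by move=> hsa; rewrite -{1}hsa cnorm_starM. Qed.

(* For commuting h and y, [w := h + i y] satisfies [w^* w = h^2 + y^2], and [h]
   is the real part of [w]. *)
Lemma cnorm_sqr_le_sum h y : self_adjoint h -> self_adjoint y -> h * y = y * h ->
  cnorm h ^+ 2 <= cnorm (h * h + y * y).
Proof.
move=> hsa ysa hy; pose w := h + 'i%C *: y.
have conji : ('i%C : R[i])^* = - 'i%C by apply/eqP; rewrite eq_complex /= oppr0 !eqxx.
have ws : star w = h - 'i%C *: y by rewrite /w starD starZ conji hsa ysa scaleNr.
have ww : star w * w = h * h + y * y.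
  rewrite ws /w mulrDr !mulrBl -!scalerAl -!scalerAr hy addrA subrK scalerA.
  by rewrite -[_ * 'i%C]expr2 sqr_i scaleN1r opprK.
rewrite -ww cnorm_starM ler_pXn2r ?nnegrE ?cnorm_ge0 //.
have -> : h = 2^-1 *:: (w + star w).
  by rewrite ws /w addrACA subrr addr0 scalerDr scale_halfD.
by rewrite cnorm_half; have := cnormD w (star w); rewrite cnorm_star; lra.
Qed.

(** Squares of self-adjoint elements, to which the square-root calculus applies directly. That
    [cstar_positive] allows nothing more is the content of [pos_starM]. *)
Definition pos a : Prop := exists2 k, self_adjoint k & a = k * k.

Lemma pos_sa a : pos a -> self_adjoint a.
Proof. by case=> k ks ->; rewrite /self_adjoint starM ks. Qed.

Lemma pos0 : pos 0.
Proof. by exists 0; rewrite /self_adjoint ?star0 ?mulr0. Qed.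

Lemma pos_scale r a : 0 <= r -> pos a -> pos (r *:: a).
Proof.
move=> r0 [k ks ->]; exists (Num.sqrt r *:: k); first by rewrite /self_adjoint starZr ks.
by rewrite -scalerAl -scalerAr scalerA -rmorphM -[Num.sqrt _ * _]expr2 sqr_sqrtr.
Qed.

Lemma pos_scaleP r a : 0 < r -> pos (r *:: a) <-> pos a.
Proof.
move=> r0; split=> [h|]; last exact: pos_scale (ltW r0).
have -> : a = r^-1 *:: (r *:: a); last by apply: pos_scale; rewrite // invr_ge0 ltW.
by rewrite scalerA -rmorphM mulVf ?gt_eqF // scale1r.
Qed.

Lemma pos_sub1 a : pos a -> cnorm a <= 1 -> pos (1 - a).
Proof.
move=> [k ks ->] n1; have [y [yy _ hy]] := sqrt_unit_ball n1.
exists y => //; apply: (hy _ square_closed_self_adjoint).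
by rewrite /= /self_adjoint starM ks.
Qed.

(** The root [y] of [1 - a] commutes with the root [k] of [a], so |y|^2 <= |y^2 + k^2| = |1|.
    Together with [unit_ball_pos] this turns positivity into a norm condition. *)
Lemma pos_unit_ball a : pos a -> cnorm a <= 1 -> cnorm (1 - a) <= 1.
Proof.
move=> [k ks ->] n1; have [y [yy _ hy]] := sqrt_unit_ball n1.
have ys : self_adjoint y.
  by apply: (hy _ square_closed_self_adjoint); rewrite /= /self_adjoint starM ks.
have ky : k * y = y * k.
  by apply: (hy _ (square_closed_commutant k)); rewrite /= mulrA.
rewrite -yy cnorm_sa // (le_trans (cnorm_sqr_le_sum ys ks _)) //.
by rewrite yy subrK cnorm1_le1.
Qed.

(** The root found satisfies |1 - k| <= 1, so it has a square root in turn; this makes it positive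
    and not merely self-adjoint. *)
Lemma unit_ball_sqrt a : self_adjoint a -> cnorm (1 - a) <= 1 ->
  exists k, [/\ pos k, a = k * k & forall C, square_closed C -> C a -> C k].
Proof.
move=> asa; have sub1 C : square_closed C -> C a -> C (1 - a).
  by case=> C1 CB _ _ _ Ca; apply: (CB).
move/sqrt_unit_ball => [k [kk k1 hk]].
have {}hk C : square_closed C -> C a -> C k by move=> hC Ca; apply: hk => //; apply: sub1.
have ksa : self_adjoint k by apply: (hk _ square_closed_self_adjoint).
exists k; split=> //; last by rewrite kk opprB addrCA subrr addr0.
have [l [ll _ hl]] := sqrt_unit_ball k1; exists l; last first.
  by rewrite ll opprB addrCA subrr addr0.
apply: (hl _ square_closed_self_adjoint).
by rewrite /= /self_adjoint starB star1 ksa.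
Qed.

Lemma unit_ball_pos a : self_adjoint a -> cnorm (1 - a) <= 1 -> pos a.
Proof. by move=> asa /(unit_ball_sqrt asa) [k [/pos_sa ks -> _]]; exists k. Qed.

Lemma cnorm_scale_le1 r a : cnorm a <= r -> 0 < r -> cnorm (r^-1 *:: a) <= 1.
Proof.
move=> h r0; rewrite cnormZr gtr0_norm ?invr_gt0 //.
by rewrite mulrC ler_pdivrMr // mul1r.
Qed.

Lemma pos_sqrt a : pos a ->
  exists k, [/\ pos k, a = k * k & forall C, square_closed C -> C a -> C k].
Proof.
move=> pa; pose t := cnorm a + 1; have t0 : 0 < t by rewrite ltr_wpDl ?cnorm_ge0.
have pt : pos (t^-1 *:: a) by apply: pos_scale => //; rewrite invr_ge0 ltW.
have nt : cnorm (t^-1 *:: a) <= 1 by apply: cnorm_scale_le1; rewrite // lerDl.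
have [k [pk kk hk]] := unit_ball_sqrt (pos_sa pt) (pos_unit_ball pt nt).
exists (Num.sqrt t *:: k); split.
- by apply: pos_scale => //; apply: sqrtr_ge0.
- rewrite -scalerAl -scalerAr scalerA -rmorphM -[Num.sqrt _ * _]expr2 sqr_sqrtr ?ltW // -kk.
  by rewrite scalerA -rmorphM mulfV ?gt_eqF // scale1r.
move=> C hC Ca; have [_ _ Cr _ _] := hC; apply: (Cr); apply: hk => //; exact: (Cr).
Qed.

(** The unit ball around [1] is convex: after a common scaling by [t^-1], half the sum is the
    midpoint of two of its points. *)
Lemma posD a b : pos a -> pos b -> pos (a + b).
Proof.
move=> pa pb; pose t := cnorm a + cnorm b + 1.
have t0 : 0 < t by rewrite ltr_wpDl ?addr_ge0 ?cnorm_ge0.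
have t2 : 0 < 2 * t by rewrite mulr_gt0.
have ti : 0 <= t^-1 by rewrite invr_ge0 ltW.
have ua : cnorm (1 - t^-1 *:: a) <= 1.
  apply: pos_unit_ball; first exact: pos_scale.
  by apply: cnorm_scale_le1; rewrite // /t -addrA lerDl addr_ge0 ?cnorm_ge0.
have ub : cnorm (1 - t^-1 *:: b) <= 1.
  apply: pos_unit_ball; first exact: pos_scale.
  by apply: cnorm_scale_le1; rewrite // /t addrAC lerDr addr_ge0 ?cnorm_ge0.
apply/(@pos_scaleP (2 * t)^-1); first by rewrite invr_gt0.
have sab : self_adjoint (a + b) by rewrite /self_adjoint starD !pos_sa.
apply: unit_ball_pos; first by rewrite /self_adjoint starZr sab.
have -> : 1 - (2 * t)^-1 *:: (a + b) =
    2^-1 *:: ((1 - t^-1 *:: a) + (1 - t^-1 *:: b)).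
  rewrite addrACA -opprD -scalerDr scalerBr scalerA -rmorphM -invfM.
  by rewrite [2^-1 *:: (1 + 1)]scalerDr scale_halfD.
by rewrite cnorm_half; have := cnormD (1 - t^-1 *:: a) (1 - t^-1 *:: b); lra.
Qed.

Lemma approx_closed_pos : approx_closed [set a : A | pos a].
Proof.
move=> a ha; have asa : self_adjoint a.
  by apply: approx_closed_self_adjoint => e /ha [b /pos_sa]; exists b.
pose t := cnorm a + 1; have t0 : 0 < t by rewrite ltr_wpDl ?cnorm_ge0.
have ti : 0 < t^-1 by rewrite invr_gt0.
apply/(@pos_scaleP t^-1) => //; apply: unit_ball_pos.
  by rewrite /self_adjoint starZr asa.
(* The bound 1 keeps the norm of the approximant [b] below [t], so that the same scaling suits [b];
   the bound [t * e] makes the scaled distance at most [e]. *)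
apply/ler_addgt0Pr => e e0; pose d := Num.min 1 (t * e).
have d0 : 0 < d by rewrite lt_min ltr01 mulr_gt0.
have [b /= pb hb] := ha d d0.
have bt : cnorm b <= t.
  rewrite (le_trans (cnorm_le_dist b a)) // lerD // (le_trans hb) //.
  by rewrite ge_min lexx.
have hub : cnorm (1 - t^-1 *:: b) <= 1.
  by apply: pos_unit_ball; [apply/pos_scaleP | apply: cnorm_scale_le1].
have := cnorm_le_dist (1 - t^-1 *:: a) (1 - t^-1 *:: b).
have -> : 1 - t^-1 *:: a - (1 - t^-1 *:: b) = t^-1 *:: (b - a).
  by rewrite opprB addrC addrA subrK scalerBr.
rewrite cnormZr gtr0_norm //.
suff : t^-1 * cnorm (b - a) <= e by lra.
by rewrite ler_pdivrMl // (le_trans hb) // ge_min lexx orbT.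
Qed.

Lemma pos_sub t a : pos a -> cnorm a <= t -> pos (t *:: 1 - a).
Proof.
move=> pa; have [->|t0] := eqVneq t 0.
  move=> a0; rewrite scale0r (_ : a = 0) ?subr0; first exact: pos0.
  by apply: cnorm_eq0; apply/eqP; rewrite eq_le a0 cnorm_ge0.
move=> at_; have tp : 0 < t by rewrite lt0r t0 (le_trans (cnorm_ge0 a)).
have ti : 0 < t^-1 by rewrite invr_gt0.
apply/(@pos_scaleP t^-1) => //; rewrite scalerBr scalerA -rmorphM mulVf // scale1r.
by apply: pos_sub1; [apply/pos_scaleP | apply: cnorm_scale_le1].
Qed.

(** With a = k^2 and t - a = l^2, where [l] commutes with [k], |k|^2 <= |k^2 + l^2| <= t. *)
Lemma cnorm_pos_le t a : 0 <= t -> pos a -> pos (t *:: 1 - a) -> cnorm a <= t.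
Proof.
move=> t0 [k ks ->] /pos_sqrt [l [/pos_sa ls lE lC]].
have kl : k * l = l * k.
  apply: (lC _ (square_closed_commutant k)) => /=.
  by rewrite mulrBr mulrBl -scalerAr -scalerAl mulr1 mul1r mulrA.
rewrite cnorm_sa // (le_trans (cnorm_sqr_le_sum ks ls kl)) //.
rewrite -lE addrCA subrr addr0 cnormZr ger0_norm // ler_piMr //.
exact: cnorm1_le1.
Qed.

Lemma cnorm_pos_mono a b : pos a -> pos b -> cnorm a <= cnorm (a + b).
Proof.
move=> pa pb; apply: cnorm_pos_le; rewrite ?cnorm_ge0 //.
rewrite -(subrK b (_ - a)); apply: posD (pb).
have -> : cnorm (a + b) *:: 1 - a - b = cnorm (a + b) *:: 1 - (a + b).
  by rewrite opprD addrA.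
by apply: pos_sub => //; apply: posD.
Qed.

Lemma pos_antisym a : pos a -> pos (- a) -> a = 0.
Proof.
move=> pa pn; apply: cnorm_eq0; apply/eqP; rewrite eq_le cnorm_ge0 andbT.
by have := cnorm_pos_mono pa pn; rewrite subrr cnorm0.
Qed.

Lemma bernoulli2 t n : 0 <= t -> 1 + n%:R * t <= (1 + t) ^+ n.
Proof.
move=> t0; elim: n => [|n IH]; first by rewrite mul0r addr0 expr0.
have n0 : 0 <= n%:R :> R by rewrite ler0n.
rewrite exprS -natr1; set N := n%:R in n0 IH *.
apply: (@le_trans _ _ ((1 + t) * (1 + N * t))); first by nra.
by rewrite ler_pM2l //; lra.
Qed.

Lemma cnorm_sa_pow2 h n : self_adjoint h -> cnorm (h ^+ (2 ^ n)%N) = cnorm h ^+ (2 ^ n)%N.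
Proof.
move=> hs; elim: n => [|n IH]; first by rewrite !expr1.
have hn m : self_adjoint (h ^+ m).
  elim: m => [|m IHm]; first by rewrite /self_adjoint expr0 star1.
  by rewrite /self_adjoint exprSr starM hs IHm -exprS exprSr.
by rewrite expnS mulnC !exprM expr2 (cnorm_sa (hn _)) IH.
Qed.

(* [(1 + d d^* )^N = 1 + d q_N d^*] with [|q_N| <= N], and the norm of a
   self-adjoint element is multiplicative on powers of 2. *)
Lemma pos_opp_swap d : pos (- (star d * d)) -> pos (- (d * star d)).
Proof.
have main c : cnorm c <= 1 -> pos (- (star c * c)) -> cnorm (1 + c * star c) <= 1.
  move=> c1 pc; pose g := 1 + star c * c; pose G := 1 + c * star c.
  have g1 : cnorm g <= 1.
    rewrite /g -(opprK (star c * c)); apply: pos_unit_ball => //.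
    by rewrite cnormN cnorm_starM exprn_ile1 ?cnorm_ge0.
  have Gs : self_adjoint G by rewrite /self_adjoint starD star1 starM starK.
  have hq n : exists2 q, G ^+ n = 1 + c * q * star c & cnorm q <= n%:R.
    elim: n => [|n [q Gq qn]].
      by exists 0; rewrite ?cnorm0 // mulr0 mul0r addr0 expr0.
    exists (1 + q * g).
      rewrite exprSr Gq /G mulrDr mulr1 mulrDl mul1r -addrA; congr (_ + _).
      by rewrite addrCA /g !mulrDr !mulrDl !mulr1 !mulrA.
    rewrite (le_trans (cnormD _ _)) // -natr1 addrC lerD ?cnorm1_le1 //.
    rewrite (le_trans (cnormM _ _)) // (le_trans _ qn) // ler_piMr ?cnorm_ge0 //.
  have hG n : cnorm G ^+ (2 ^ n)%N <= 1 + (2 ^ n)%N%:R.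
    rewrite -cnorm_sa_pow2 //; have [q -> qn] := hq (2 ^ n)%N.
    rewrite (le_trans (cnormD _ _)) // lerD ?cnorm1_le1 //.
    rewrite (le_trans _ qn) // (le_trans (cnormM _ _)) //.
    rewrite (@le_trans _ _ (cnorm (c * q))) ?ler_piMr ?cnorm_ge0 ?cnorm_star //.
    by rewrite (le_trans (cnormM _ _)) // ler_piMl ?cnorm_ge0.
  rewrite leNgt; apply/negP => G1; pose e := cnorm G - 1.
  have e0 : 0 < e by rewrite subr_gt0.
  (* For |G| = 1 + e and N = 2^n, Bernoulli gives (1 + N e)^2 <= |G|^(2N) <= 1 + 2N. If N e^2 > 2,
     the quadratic term alone contradicts this. *)
  pose n := Num.bound (2 / e ^+ 2).
  have : 2 / e ^+ 2 < (2 ^ n)%N%:R :> R.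
    rewrite (lt_trans (archi_boundP _)) ?divr_ge0 ?exprn_ge0 ?(ltW e0) //.
    by rewrite ltr_nat ltn_expl.
  rewrite ltr_pdivrMr ?exprn_gt0 // => hn.
  have := hG n.+1; rewrite expnS mulnC exprM natrM.
  have := bernoulli2 (2 ^ n)%N (ltW e0); rewrite /e [1 + (_ - 1)]addrC subrK -/e.
  have : 0 <= (2 ^ n)%N%:R :> R by rewrite ler0n.
  set N := (2 ^ n)%N%:R in hn *; set X := cnorm G ^+ _ => N0 hX hX2.
  have : (1 + N * e) ^+ 2 <= X ^+ 2.
    have B0 : 0 <= 1 + N * e by rewrite addr_ge0 ?mulr_ge0 ?(ltW e0).
    by rewrite ler_pXn2r ?nnegrE ?(le_trans B0 hX).
  nra.
move=> pd; pose t := cnorm d + 1; have t0 : 0 < t by rewrite ltr_wpDl ?cnorm_ge0.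
have ti : 0 < t^-1 by rewrite invr_gt0.
have ti2 : 0 < t^-1 * t^-1 by rewrite mulr_gt0.
pose c := t^-1 *:: d.
have cc : star c * c = (t^-1 * t^-1) *:: (star d * d).
  by rewrite /c starZr -scalerAl -scalerAr scalerA -rmorphM.
have cc' : c * star c = (t^-1 * t^-1) *:: (d * star d).
  by rewrite /c starZr -scalerAl -scalerAr scalerA -rmorphM.
apply/(@pos_scaleP (t^-1 * t^-1)) => //; rewrite scalerN -cc'.
apply: unit_ball_pos; first by rewrite /self_adjoint starN starM starK.
rewrite opprK; apply: main; first by apply: cnorm_scale_le1; rewrite // lerDl.
by rewrite cc -scalerN; apply/pos_scaleP.
Qed.

(** This is i/2, so [im_part] is minus the customary imaginary part; what counts in the end is its
    square. *)
Definition im_coeff : R[i] := Complex 0 2^-1.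
Definition re_part d : A := 2^-1 *:: (d + star d).
Definition im_part d : A := im_coeff *: (d - star d).

Lemma re_part_sa d : self_adjoint (re_part d).
Proof. by rewrite /self_adjoint starZr starD starK addrC. Qed.

Lemma im_part_sa d : self_adjoint (im_part d).
Proof.
have conjw : im_coeff^* = - im_coeff by apply/eqP; rewrite eq_complex /= oppr0 !eqxx.
by rewrite /self_adjoint starZ starB starK conjw -[star d - d]opprB scalerN scaleNr opprK.
Qed.

Lemma re_sqr_im_sqr d : re_part d * re_part d + im_part d * im_part d =
  2^-1 *:: (star d * d + d * star d).
Proof.
have ww : im_coeff * im_coeff = - (2^-1 * 2^-1)%:C%C.
  by apply/eqP; rewrite eq_complex /= !(mul0r, mulr0) sub0r addr0 oppr0 !eqxx.
rewrite -!scalerAl -!scalerAr !scalerA ww scaleNr -rmorphM -scalerBr.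
rewrite rmorphM -scalerA; congr (_ *: _).
have -> : (d + star d) * (d + star d) - (d - star d) * (d - star d) =
   (star d * d + d * star d) + (star d * d + d * star d).
  rewrite mulrDr mulrBr opprB [_ * star d - _]addrC addrACA -mulrBl -mulrDl.
  have -> : d + star d - (d - star d) = star d + star d.
    by rewrite opprB addrC addrA subrK.
  have -> : d + star d + (d - star d) = d + d by rewrite addrACA subrr addr0.
  by rewrite !mulrDl addrACA.
by rewrite scalerDr scale_halfD.
Qed.

(** Half of d^* d + d d^* is a sum of two squares of self-adjoint elements, hence positive; as - d
    d^* is positive too, so is d^* d. *)
Lemma pos_opp_starM_eq0 d : pos (- (star d * d)) -> d = 0.
Proof.
move=> pd; have pd' := pos_opp_swap pd.
suff pp : pos (star d * d + d * star d).
  apply: starM_eq0; apply: pos_antisym => //.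
  by rewrite -(addrK (d * star d) (star d * d)); apply: posD.
apply/(@pos_scaleP 2^-1); first by rewrite invr_gt0.
rewrite -re_sqr_im_sqr; apply: posD.
  by exists (re_part d); first exact: re_part_sa.
by exists (im_part d); first exact: im_part_sa.
Qed.

(* Kelley-Vaught: with [p := |h|], [h := c^* c] and [g := p - h], one has
   [(c g)^* (c g) = - g p g]. *)
Lemma pos_starM c : pos (star c * c).
Proof.
set h := star c * c; have hs : self_adjoint h by rewrite /self_adjoint starM starK.
have [|p [pp pE pC]] := @pos_sqrt (h * h); first by exists h.
have [m [/pos_sa ms mE mC]] := pos_sqrt pp; have ps := pos_sa pp.
have hp : h * p = p * h by apply: (pC _ (square_closed_commutant h)); rewrite /= mulrA.
have hm : h * m = m * h by apply: (mC _ (square_closed_commutant h)).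
have mp : m * p = p * m by rewrite mE mulrA.
pose g := p - h; have gs : self_adjoint g by rewrite /self_adjoint starB hs ps.
have hg : h * g = - (p * g) by rewrite /g !mulrBr hp pE opprB.
have gm : g * m = m * g by rewrite /g mulrBl mulrBr hm mp.
have mgs : self_adjoint (m * g) by rewrite /self_adjoint starM ms gs.
have E : star (c * g) * (c * g) = - ((m * g) * (m * g)).
  rewrite starM gs mulrA -(mulrA g) -/h -mulrA hg mulrN mE.
  by rewrite !mulrA gm.
have /starM_eq0/eqP : star (m * g) * (m * g) = 0.
  have cg0 : c * g = 0 by apply: pos_opp_starM_eq0; rewrite E opprK; exists (m * g).
  by apply/eqP; rewrite mgs -oppr_eq0 -E cg0 mulr0.
move/eqP => mg0; have pg0 : p * g = 0 by rewrite mE -mulrA mg0 mulr0.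
have g0 : g = 0.
  by apply: starM_eq0; rewrite gs {1}/g mulrBl hg pg0 oppr0 subr0.
by have /eqP := g0; rewrite subr_eq0 => /eqP <-.
Qed.

Lemma cstar_positiveE a : cstar_positive a <-> pos a.
Proof. by split=> [[c ->]|[k ks ->]]; [apply: pos_starM | exists k; rewrite ks]. Qed.

End Positive.

(** The square root of |a|^2 - a^* a is mapped to one of |a|^2 - f(a)^* f(a). This is what makes the
    gauge maps contractive. *)
Lemma cnorm_morph_le (R : realType) (A D : cstarAlgType R) (f : {lrmorphism A -> D}) :
  (forall a, f (star a) = star (f a)) -> forall a, cnorm (f a) <= cnorm a.
Proof.
move=> fs a; rewrite -(ler_pXn2r (ltn0Sn 1)) ?nnegrE ?cnorm_ge0 // -cnorm_starM.
apply: cnorm_pos_le; rewrite ?exprn_ge0 ?cnorm_ge0 //; first exact: pos_starM.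
have [k ks kE] : pos (cnorm a ^+ 2 *:: 1 - star a * a).
  by apply: pos_sub; [apply: pos_starM | rewrite cnorm_starM].
exists (f k); first by rewrite /self_adjoint -fs ks.
have fM x y : f (x * y) = f x * f y by apply: rmorphM.
have fB x y : f (x - y) = f x - f y by apply: raddfB.
have fZ z x : f (z *: x) = z *: f x by apply: linearZ.
by rewrite -fM -kE fB fZ fM fs rmorph1.
Qed.

(** * Limits and iterated two-point averages *)

Section Limits.
Variables (R : realType) (A : cstarAlgType R).
Implicit Types (a b c l : A) (x y : nat -> A) (r t : R).

Lemma tends_const l : tends (fun=> l) l.
Proof. by move=> e e0; exists 0%N => n _; rewrite subrr cnorm0 ltW. Qed.

Lemma tends_near x y l k : (forall n, (k <= n)%N -> x n = y n) -> tends x l -> tends y l.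
Proof.
move=> xy h e /h [N hN]; exists (maxn N k) => n; rewrite geq_max => /andP[Nn kn].
by rewrite -xy // hN.
Qed.

Lemma tends_uniq x l l' : tends x l -> tends x l' -> l = l'.
Proof.
move=> h h'; apply/eqP; rewrite -subr_eq0; apply/eqP; apply: cnorm_small => e e0.
have e2 : 0 < e / 2 by rewrite divr_gt0.
have [N hN] := h _ e2; have [N' hN'] := h' _ e2; pose n := maxn N N'.
have := hN n (leq_maxl _ _); have := hN' n (leq_maxr _ _).
by have := cnorm_dist_triangle (x n) l l'; rewrite (cnorm_distC l (x n)); lra.
Qed.

Lemma tendsD x y l l' : tends x l -> tends y l' -> tends (fun n => x n + y n) (l + l').
Proof.
move=> h h' e e0; have e2 : 0 < e / 2 by rewrite divr_gt0.
have [N hN] := h _ e2; have [N' hN'] := h' _ e2.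
exists (maxn N N') => n; rewrite geq_max => /andP[/hN h1 /hN' h2].
by rewrite opprD addrACA (le_trans (cnormD _ _)) //; lra.
Qed.

Lemma tends_lip (f : A -> A) (K : R) x l :
  (forall a b, cnorm (f a - f b) <= K * cnorm (a - b)) ->
  tends x l -> tends (fun n => f (x n)) (f l).
Proof.
move=> hf h e e0; have K1 : 0 < `|K| + 1 by rewrite ltr_wpDl.
have [|N hN] := h (e / (`|K| + 1)); first by rewrite divr_gt0.
exists N => n /hN; rewrite ler_pdivlMr // => hn.
rewrite (le_trans (hf _ _)) //; have := ler_norm K; have := cnorm_ge0 (x n - l); nra.
Qed.

Lemma tends_MM b c x l : tends x l -> tends (fun n => b * x n * c) (b * l * c).
Proof.
apply: (@tends_lip (fun a => b * a * c) (cnorm b * cnorm c)) => p q.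
rewrite -mulrBl -mulrBr (le_trans (cnormM _ _)) // mulrAC ler_wpM2r ?cnorm_ge0 //.
exact: cnormM.
Qed.

Lemma tendsZ (z : R[i]) x l : tends x l -> tends (fun n => z *: x n) (z *: l).
Proof.
by apply: (@tends_lip (fun a => z *: a) (Normc.normc z)) => p q; rewrite -scalerBr cnormZ.
Qed.

Lemma tends_cnorm_le x l r : (forall n, cnorm (x n) <= r) -> tends x l -> cnorm l <= r.
Proof.
move=> hx h; apply/ler_addgt0Pr => e /h [N /(_ N (leqnn _))].
by rewrite cnorm_distC; have := cnorm_le_dist l (x N); have := hx N; lra.
Qed.

End Limits.

(** * Iterated two-point averages of contractive positive maps *)

Section Averages.
Variables (R : realType) (A : cstarAlgType R) (al : nat -> A -> A).
Hypotheses (alD : forall i a b, al i (a + b) = al i a + al i b)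
  (alZ : forall i (z : R[i]) a, al i (z *: a) = z *: al i a)
  (al_le : forall i a, cnorm (al i a) <= cnorm a)
  (al_pos : forall i a, pos a -> pos (al i a)).
Implicit Types (a b c l : A).

Definition half_sum i a : A := 2^-1 *:: (a + al i a).

(** Index [m] is outermost, so late averages act first. Thus [avg_addn] can split off a late block,
    close to the identity, from a fixed number of early averages. *)
Fixpoint avg m k a : A := if k is k'.+1 then half_sum m (avg m.+1 k' a) else a.

Lemma avgD m k a b : avg m k (a + b) = avg m k a + avg m k b.
Proof.
by elim: k m => //= k IH m; rewrite IH /half_sum alD addrACA scalerDr.
Qed.

Lemma avgZ m k (z : R[i]) a : avg m k (z *: a) = z *: avg m k a.
Proof.
elim: k m => //= k IH m.
by rewrite IH /half_sum alZ -scalerDr !scalerA mulrC.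
Qed.

Lemma avgB m k a b : avg m k (a - b) = avg m k a - avg m k b.
Proof. by rewrite avgD -scaleN1r avgZ scaleN1r. Qed.

Lemma avg_le m k a : cnorm (avg m k a) <= cnorm a.
Proof.
elim: k m => //= k IH m; rewrite /half_sum cnorm_half.
have := cnormD (avg m.+1 k a) (al m (avg m.+1 k a)).
by have := al_le m (avg m.+1 k a); have := IH m.+1; lra.
Qed.

Lemma avg_pos m k a : pos a -> pos (avg m k a).
Proof.
move=> pa; elim: k m => //= k IH m.
by apply: pos_scale; [rewrite invr_ge0 ler0n | apply: posD => //; apply: al_pos].
Qed.

Lemma avg_addn m k n a : avg m (k + n) a = avg m k (avg (m + k) n a).
Proof.
by elim: k m => [|k IH] m /=; rewrite ?addn0 // addnS -addSn IH.
Qed.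

(** A sum of positive elements has at least the norm of either summand, so each stage at most halves
    the norm. *)
Lemma avg_pos_ge m k a : pos a -> 2^-1 ^+ k * cnorm a <= cnorm (avg m k a).
Proof.
move=> pa; elim: k m => [|k IH] m /=; first by rewrite expr0 mul1r.
rewrite /half_sum cnorm_half exprS -mulrA ler_pM2l ?invr_gt0 //.
rewrite (le_trans (IH m.+1)) //; apply: cnorm_pos_mono; first exact: avg_pos.
by apply: al_pos; apply: avg_pos.
Qed.

(** The uniformity in [k] yields both convergence and, with [avg_pos_ge], faithfulness of the
    limit. *)
Definition slow a : Prop :=
  forall e, 0 < e -> exists m0, forall m k, (m0 <= m)%N -> cnorm (avg m k a - a) <= e.

Lemma slowD a b : slow a -> slow b -> slow (a + b).
Proof.
move=> ha hb e e0; have e2 : 0 < e / 2 by rewrite divr_gt0.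
have [p hp] := ha _ e2; have [q hq] := hb _ e2.
exists (maxn p q) => m k; rewrite geq_max => /andP[pm qm].
rewrite avgD opprD addrACA (le_trans (cnormD _ _)) //.
by have := hp m k pm; have := hq m k qm; lra.
Qed.

Lemma approx_closed_slow : approx_closed [set a | slow a].
Proof.
move=> a ha e e0; have e3 : 0 < e / 3 by rewrite divr_gt0.
have [b hb ab] := ha _ e3; have [m0 hm] := hb _ e3; exists m0 => m k m0m.
have -> : avg m k a - a = avg m k (a - b) + (avg m k b - b) + (b - a).
  by rewrite avgB !addrA subrK subrK.
rewrite (le_trans (cnormD _ _)) //.
have := cnormD (avg m k (a - b)) (avg m k b - b); have := hm m k m0m.
by have := avg_le m k (a - b); rewrite (cnorm_distC a); lra.
Qed.

(** [d] is a potential whose drops bound the single displacements. Since [al m] is contractive, the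
    outer average adds at most half of its own displacement to the inner one. *)
Lemma avg_telescope (d : nat -> R) m k a :
  (forall i, (m <= i)%N -> cnorm (al i a - a) <= d i - d i.+1) ->
  cnorm (avg m k a - a) <= d m - d (m + k)%N.
Proof.
elim: k m => [|k IH] m hd /=; first by rewrite addn0 !subrr cnorm0.
have h1 : cnorm (avg m.+1 k a - a) <= d m.+1 - d (m.+1 + k)%N.
  by apply: IH => i mi; apply: hd; apply: ltnW.
have h2 := hd m (leqnn m); rewrite /half_sum.
have -> : 2^-1 *:: (avg m.+1 k a + al m (avg m.+1 k a)) - a =
    2^-1 *:: ((avg m.+1 k a - a) + al m (avg m.+1 k a - a) + (al m a - a)).
  rewrite -[X in _ - X = _](scale_halfD a) -scalerDr -scalerBr; congr (_ *: _).
  have -> : al m (avg m.+1 k a - a) = al m (avg m.+1 k a) - al m a.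
    by rewrite alD -scaleN1r alZ scaleN1r.
  by rewrite -[RHS]addrA [_ - al m a + _]addrA subrK [RHS]addrACA opprD.
rewrite cnorm_half.
have := cnormD (avg m.+1 k a - a + al m (avg m.+1 k a - a)) (al m a - a).
have := cnormD (avg m.+1 k a - a) (al m (avg m.+1 k a - a)).
have := al_le m (avg m.+1 k a - a); have := cnorm_ge0 (al m a - a).
by rewrite addnS -addSn; lra.
Qed.

Lemma slow_telescope (d : nat -> R) a :
  (exists m, forall i, (m <= i)%N -> cnorm (al i a - a) <= d i - d i.+1) ->
  (forall i, 0 <= d i) ->
  (forall e, 0 < e -> exists N, forall n, (N <= n)%N -> d n <= e) -> slow a.
Proof.
move=> [m0 hd] d0 dlim e /dlim [N hN]; exists (maxn N m0) => m k.
rewrite geq_max => /andP[/hN de m0m].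
have : cnorm (avg m k a - a) <= d m - d (m + k)%N.
  by apply: avg_telescope => i mi; apply: hd; apply: leq_trans mi.
by have := d0 (m + k)%N; lra.
Qed.

Lemma slow_lim a : slow a -> exists l, tends (fun n => avg 0 n a) l.
Proof.
move=> ha; apply: cauchy_lim => e e0; have [|m0 hm] := ha (e / 2); first by rewrite divr_gt0.
exists m0 => m n /andP[m0n nm].
have h p : (m0 <= p)%N -> cnorm (avg 0 p a - avg 0 m0 a) <= e / 2.
  move=> m0p; rewrite -(subnKC m0p) avg_addn add0n -avgB (le_trans (avg_le _ _ _)) //.
  exact: hm.
have := h n m0n; have := h m (leq_trans m0n nm).
have := cnorm_dist_triangle (avg 0 m0 a) (avg 0 m a) (avg 0 n a).
by rewrite (cnorm_distC (avg 0 m0 a)); lra.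
Qed.

Lemma avg_lim_faithful a : slow a -> pos a -> tends (fun n => avg 0 n a) 0 -> a = 0.
Proof.
move=> ha pa h0; apply: cnorm_small => e e0.
have e2 : 0 < e / 2 by rewrite divr_gt0.
have [m hm] := ha _ e2.
(* The threshold anticipates the factor 2^-m that the first [m] averages may cost. *)
have [|N hN] := h0 (2^-1 ^+ m * (e / 2)); first by rewrite mulr_gt0 ?exprn_gt0 ?invr_gt0.
have := hN (m + N)%N (leq_addl _ _); rewrite subr0 avg_addn add0n => h1.
have := le_trans (avg_pos_ge 0 m (avg_pos m N pa)) h1.
rewrite ler_pM2l ?exprn_gt0 ?invr_gt0 // => h2.
have := cnorm_le_dist a (avg m N a); rewrite cnorm_distC.
by have := hm m N (leqnn m); lra.
Qed.

Lemma avg_bimodule b c a m k : (forall i x, al i (b * x * c) = b * al i x * c) ->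
  avg m k (b * a * c) = b * avg m k a * c.
Proof.
move=> h; elim: k m => //= k IH m.
by rewrite IH /half_sum h -mulrDl -mulrDr -scalerAr -scalerAl.
Qed.

Lemma avg_fixed m k a : (forall i, (m <= i)%N -> al i a = a) -> avg m k a = a.
Proof.
elim: k m => //= k IH m h; rewrite IH => [|i mi]; last by apply: h; apply: ltnW.
by rewrite /half_sum h // scalerDr scale_halfD.
Qed.

End Averages.

(** * Dyadic roots of unity *)

Section DyadicRoots.
Variable R : realType.
Implicit Types z : R[i].

(** Half-angle formulas on the upper unit semicircle; the branch with nonnegative real part drives
    the iterates to 1. *)
Definition upper_sqrt z : R[i] :=
  Complex (Num.sqrt ((1 + complex.Re z) / 2)) (Num.sqrt ((1 - complex.Re z) / 2)).

Definition dyadic_root n : R[i] := iter n upper_sqrt (-1).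

Let on_upper z := 0 <= complex.Im z /\ complex.Re z ^+ 2 + complex.Im z ^+ 2 = 1.

Let upper_Re z : on_upper z -> -1 <= complex.Re z <= 1.
Proof. by case=> h0 h1; apply/andP; split; nra. Qed.

Let upper_sqrt_upper z : on_upper z -> on_upper (upper_sqrt z).
Proof.
move=> /upper_Re /andP[h1 h2]; split; rewrite ?sqrtr_ge0 //= !sqr_sqrtr; lra.
Qed.

Let upper_sqrtK z : on_upper z -> upper_sqrt z ^+ 2 = z.
Proof.
move=> hz; have /andP[h1 h2] := upper_Re hz; case: hz h1 h2 => h0 e h1 h2.
have p1 : 0 <= (1 + complex.Re z) / 2 by lra.
have p2 : 0 <= (1 - complex.Re z) / 2 by lra.
case: z h0 e h1 h2 p1 p2 => c s /= h0 e h1 h2 p1 p2.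
apply/eqP; rewrite eq_complex /= -!expr2 !sqr_sqrtr //; apply/andP; split; apply/eqP.
  by lra.
rewrite [X in _ + X]mulrC -sqrtrM //.
have -> : (1 + c) / 2 * ((1 - c) / 2) = (s / 2) ^+ 2 by nra.
by rewrite sqrtr_sqr ger0_norm ?divr_ge0 //; lra.
Qed.

Let root_upper n : on_upper (dyadic_root n).
Proof.
elim: n => [|n IH]; last by rewrite /dyadic_root iterS; apply: upper_sqrt_upper.
by rewrite /on_upper /= oppr0 lexx sqrrN expr1n expr0n addr0.
Qed.

Lemma dyadic_root0 : dyadic_root 0 = -1. Proof. by []. Qed.

Lemma dyadic_rootS n : dyadic_root n.+1 ^+ 2 = dyadic_root n.
Proof. exact: (upper_sqrtK (root_upper n)). Qed.

Lemma dyadic_root_unit n : dyadic_root n * (dyadic_root n)^* = 1.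
Proof.
have [_ e] := root_upper n; case: (dyadic_root n) e => c s /= e.
by apply/eqP; rewrite eq_complex /= -e mulrN opprK -!expr2 eqxx mulrN mulrC addNr eqxx.
Qed.

Lemma normc_dyadic_root n : Normc.normc (dyadic_root n) = 1.
Proof. by have [_ e] := root_upper n; case: (dyadic_root n) e => c s /= ->; rewrite sqrtr1. Qed.

Definition root_gap n : R := Normc.normc (dyadic_root n - 1).

Lemma root_gap_ge0 n : 0 <= root_gap n.
Proof. by rewrite /root_gap; case: (_ - _) => x y; apply: sqrtr_ge0. Qed.

(** From w_n - 1 = (w_(n+1) - 1)(w_(n+1) + 1): the last factor has modulus at least sqrt 2, its root
    having nonnegative real part, and 4/3 is a rational bound below sqrt 2. *)
Lemma root_gapS n : root_gap n.+1 <= 3 / 4 * root_gap n.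
Proof.
have h : 4 / 3 <= Normc.normc (dyadic_root n.+1 + 1).
  have [_ e] := root_upper n.+1; have : 0 <= complex.Re (dyadic_root n.+1) by apply: sqrtr_ge0.
  case: (dyadic_root n.+1) e => c s /= e c0.
  rewrite -[leLHS]ger0_norm -?sqrtr_sqr; last by lra.
  by rewrite ler_sqrt addr0; nra.
have -> : root_gap n = root_gap n.+1 * Normc.normc (dyadic_root n.+1 + 1).
  by rewrite /root_gap -(dyadic_rootS n) -[X in _ - X](expr1n _ 2) subr_sqr Normc.normcM.
by have := root_gap_ge0 n.+1; nra.
Qed.

Lemma root_gap_lim e : 0 < e -> exists N, forall n, (N <= n)%N -> root_gap n <= e.
Proof.
move=> e0.
have h n : root_gap n * (4 / 3) ^+ n <= root_gap 0.
  elim: n => [|n IH]; first by rewrite expr0 mulr1.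
  have := root_gapS n; have : 0 <= (4 / 3 : R) ^+ n by rewrite exprn_ge0; lra.
  by rewrite exprSr; nra.
have g0 := root_gap_ge0 0; exists (Num.bound (3 * root_gap 0 / e)) => n Nn.
have : 3 * root_gap 0 / e < n%:R.
  by rewrite (lt_le_trans (archi_boundP _)) ?ler_nat ?divr_ge0 ?mulr_ge0 // ltW.
rewrite ltr_pdivrMr // => hn; rewrite leNgt; apply/negP => hlt.
have := h n; have := @bernoulli2 R (1 / 3) n.
have -> : 1 + 1 / 3 = 4 / 3 :> R by lra.
have -> : 0 <= 1 / 3 :> R by lra.
move=> /(_ isT); have n0 : 0 <= n%:R :> R by rewrite ler0n.
by set X := _ ^+ n => hX hh; nra.
Qed.

(** A gauge map multiplies a word by such a product, in which each of the p + q unimodular factors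
    contributes at most |z - 1|. *)
Lemma normc_unit_pow z p q : Normc.normc z = 1 -> z * z^* = 1 ->
  Normc.normc (z ^+ p * (z^*) ^+ q - 1) <= (p + q)%:R * Normc.normc (z - 1).
Proof.
move=> z1 zz; have zc1 : Normc.normc (z^*) = 1.
  by move: z1; case: z {zz} => a b /=; rewrite sqrrN.
have zc : Normc.normc (z^* - 1) = Normc.normc (z - 1).
  by case: z {z1 zz zc1} => a b /=; rewrite oppr0 !addr0 sqrrN.
have step (x y : R[i]) : Normc.normc y = 1 ->
    Normc.normc (x * y - 1) <= Normc.normc (x - 1) + Normc.normc (y - 1).
  move=> y1; have -> : x * y - 1 = (x - 1) * y + (y - 1) by rewrite mulrBl mul1r addrA subrK.
  by rewrite (le_trans (le_normcD _ _)) // Normc.normcM y1 mulr1.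
elim: q => [|q IH].
  rewrite addn0 expr0 mulr1; elim: p => [|p IHp].
    by rewrite expr0 subrr Normc.normc0 mul0r.
  by rewrite exprSr (le_trans (step _ _ z1)) // -natr1 mulrDl mul1r lerD.
rewrite exprSr mulrA (le_trans (step _ _ zc1)) // addnS -natr1 mulrDl mul1r.
by rewrite lerD // zc.
Qed.

Lemma dyadic_root_pow n : dyadic_root n ^+ (2 ^ n)%N = -1.
Proof.
elim: n => [|n IH]; first by rewrite expr1.
by rewrite expnS exprM dyadic_rootS.
Qed.

Let odd_partP k : (0 < k)%N -> exists a m, odd m /\ k = (2 ^ a * m)%N.
Proof.
move=> k0; have [m cm e] := pfactor_coprime (isT : prime 2) k0.
by exists (logn 2 k), m; rewrite -coprime2n mulnC.
Qed.

(** Write k = 2^a m with m odd: w_a^(2^a) = -1, and the odd power keeps this value. *)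
Lemma dyadic_root_minus1 k : (0 < k)%N -> exists n, dyadic_root n ^+ k = -1.
Proof.
move=> /odd_partP [a [m [om ->]]]; exists a.
by rewrite exprM dyadic_root_pow -signr_odd om expr1.
Qed.

Lemma dyadic_root_neq1 k : (0 < k)%N ->
  exists N, forall n, (N <= n)%N -> dyadic_root n ^+ k <> 1.
Proof.
move=> /odd_partP [a [m [om ->]]]; exists a => n an e.
have : (dyadic_root n ^+ (2 ^ a * m)%N) ^+ (2 ^ (n - a))%N = -1.
  rewrite -exprM mulnC mulnA -expnD subnK // exprM dyadic_root_pow.
  by rewrite -signr_odd om expr1.
rewrite e expr1n => /eqP; rewrite -subr_eq0 opprK => /eqP h.
by have := pnatr_eq0 R[i] 2; rewrite mulr2n h eqxx.
Qed.

Lemma dyadic_root_balance p q : p <> q ->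
  exists n, dyadic_root n ^+ p * ((dyadic_root n)^*) ^+ q = -1.
Proof.
have key z a d : z * z^* = 1 -> z ^+ a * (z^*) ^+ (a + d) = (z^*) ^+ d.
  by move=> zz; rewrite exprD mulrA -exprMn zz expr1n mul1r.
have key' z a d : z * z^* = 1 -> z ^+ (a + d) * (z^*) ^+ a = z ^+ d.
  by move=> zz; rewrite exprD mulrAC -exprMn zz expr1n mul1r.
move=> /eqP; rewrite neq_ltn => /orP[pq|pq].
  have [|n hn] := @dyadic_root_minus1 (q - p)%N; first by rewrite subn_gt0.
  exists n; rewrite -(subnKC (ltnW pq)) key ?dyadic_root_unit //.
  by rewrite -rmorphXn hn rmorphN1.
have [|n hn] := @dyadic_root_minus1 (p - q)%N; first by rewrite subn_gt0.
by exists n; rewrite -(subnKC (ltnW pq)) key' ?dyadic_root_unit.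
Qed.

End DyadicRoots.

(** * Generated subalgebras and words in u and s *)

Section Generated.
Variables (R : realType) (A : cstarAlgType R).
Implicit Types (a b c x y z : A) (C S : set A).

Lemma cstar_gen_min S C : cstar_subalgebra C -> S `<=` C -> cstar_gen S `<=` C.
Proof. by move=> hC SC x; apply. Qed.

Lemma cstar_gen_self S : S `<=` cstar_gen S.
Proof. by move=> x Sx C [_]; apply. Qed.

Lemma cstar_gen_subalgebra S : cstar_subalgebra (cstar_gen S).
Proof.
split=> [C [[C0 ? ? ? ?]] //|a b ha hb C hC|z a ha C hC|a b ha hb C hC|].
- by have := ha C hC; have := hb C hC; case: hC => [[_ CD _ _ _] _] hb' ha'; apply: CD.
- by have := ha C hC; case: hC => [[_ _ CZ _ _] _]; apply: CZ.
- by have := ha C hC; have := hb C hC; case: hC => [[_ _ _ CM _] _] hb' ha'; apply: CM.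
split=> [a ha C hC|x a hx xa C hC].
  by have := ha C hC; case: hC => [[_ _ _ _ [Cs _]] _]; apply: Cs.
have Cx n : C (x n) := hx n C hC.
by case: hC => [[_ _ _ _ [_ Ccl]] _]; apply: (Ccl x).
Qed.

Lemma approx_closed_lip (f : A -> A) (K : R) C :
  (forall a b, cnorm (f a - f b) <= K * cnorm (a - b)) ->
  approx_closed C -> approx_closed [set a | C (f a)].
Proof.
move=> hf Ccl a ha; apply: Ccl => e e0; have K1 : 0 < `|K| + 1 by rewrite ltr_wpDl.
have [|b Cb hb] := ha (e / (`|K| + 1)); first by rewrite divr_gt0.
exists (f b) => //; rewrite (le_trans (hf _ _)) //; move: hb; rewrite ler_pdivlMr //.
by have := ler_norm K; have := cnorm_ge0 (b - a); nra.
Qed.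

Lemma cstar_subalgebra_commutant S :
  cstar_subalgebra [set x : A | forall a, S a -> a * x = x * a /\ star a * x = x * star a].
Proof.
split=> /= [a|x y hx hy a Sa|z x hx a Sa|x y hx hy a Sa|].
- by rewrite !mul0r !mulr0.
- by have [h1 h2] := hx a Sa; have [h3 h4] := hy a Sa; rewrite !mulrDl !mulrDr h1 h2 h3 h4.
- by have [h1 h2] := hx a Sa; rewrite -!scalerAl -!scalerAr h1 h2.
- have [h1 h2] := hx a Sa; have [h3 h4] := hy a Sa.
  by split; [rewrite mulrA h1 -mulrA h3 | rewrite mulrA h2 -mulrA h4]; rewrite mulrA.
split=> [x hx a Sa|].
  have [h1 h2] := hx a Sa; split; last by rewrite -!starM h1.
  by rewrite -[a]starK -!starM h2.
apply/cstar_closedP => x hx a Sa; split.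
  by apply: (approx_closed_commutant (z := a)) => e /hx [b hb]; exists b => //=; case: (hb a Sa).
apply: (approx_closed_commutant (z := star a)) => e /hx [b hb]; exists b => //=.
by case: (hb a Sa).
Qed.

Lemma cstar_subalgebra_pullback (f : A -> A) (K : R) C : cstar_subalgebra C ->
  f 0 = 0 -> (forall a b, f (a + b) = f a + f b) -> (forall (z : R[i]) a, f (z *: a) = z *: f a) ->
  (forall a b, f (a * b) = f a * f b) -> (forall a, f (star a) = star (f a)) ->
  (forall a, cnorm (f a) <= K * cnorm a) ->
  cstar_subalgebra [set a | C (f a)].
Proof.
move=> [C0 CD CZ CM [Cs /cstar_closedP Ccl]] f0 fD fZ fM fs fK; split=> /=.
- by rewrite f0.
- by move=> a b ha hb; rewrite fD; apply: CD.
- by move=> z a ha; rewrite fZ; apply: CZ.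
- by move=> a b ha hb; rewrite fM; apply: CM.
split=> [a ha|]; first by rewrite fs; apply: Cs.
apply/cstar_closedP; apply: (@approx_closed_lip _ K) => // a b.
by have -> : f a - f b = f (a - b) by rewrite fD -[- b]scaleN1r fZ scaleN1r.
Qed.

Lemma cstar_subalgebra_closure C : C 0 -> (forall a b, C a -> C b -> C (a + b)) ->
  (forall (z : R[i]) a, C a -> C (z *: a)) -> (forall a b, C a -> C b -> C (a * b)) ->
  (forall a, C a -> C (star a)) ->
  cstar_subalgebra [set a | forall e : R, 0 < e -> exists2 b, C b & cnorm (b - a) <= e].
Proof.
move=> C0 CD CZ CM Cs; split=> /=.
- by move=> e e0; exists 0; rewrite ?subrr ?cnorm0 ?ltW.
- move=> a b ha hb e e0; have e2 : 0 < e / 2 by rewrite divr_gt0.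
  have [a' Ca ea] := ha _ e2; have [b' Cb eb] := hb _ e2.
  exists (a' + b'); first exact: CD.
  by rewrite opprD addrACA (le_trans (cnormD _ _)) //; lra.
- move=> z a ha e e0.
  have z0 : 0 <= Normc.normc z by case: z => x y; apply: sqrtr_ge0.
  have [|a' Ca ea] := ha (e / (Normc.normc z + 1)); first by rewrite divr_gt0 ?ltr_wpDl.
  exists (z *: a'); first exact: CZ.
  move: ea; rewrite -scalerBr cnormZ ler_pdivlMr ?ltr_wpDl //.
  by have := cnorm_ge0 (a' - a); nra.
- move=> a b ha hb e e0; pose M := cnorm a + cnorm b + 1.
  have M0 : 0 < M by rewrite ltr_wpDl ?addr_ge0 ?cnorm_ge0.
  pose d := Num.min 1 (e / M); have d0 : 0 < d by rewrite lt_min ltr01 divr_gt0.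
  have [a' Ca ea] := ha _ d0; have [b' Cb eb] := hb _ d0.
  exists (a' * b'); first exact: CM.
  have -> : a' * b' - a * b = (a' - a) * b' + a * (b' - b).
    by rewrite mulrBl mulrBr addrA subrK.
  have d1 : d <= 1 by rewrite ge_min lexx.
  have dM : d * M <= e by rewrite -ler_pdivlMr // ge_min lexx orbT.
  rewrite (le_trans (cnormD _ _)) //.
  have := cnormM (a' - a) b'; have := cnormM a (b' - b).
  have := cnorm_le_dist b' b; have := cnorm_ge0 (a' - a); have := cnorm_ge0 (b' - b).
  have := cnorm_ge0 a; have := cnorm_ge0 b; have := cnorm_ge0 b'.
  by rewrite /M in dM; nra.
split=> [a ha e e0|].
  have [b Cb eb] := ha _ e0; exists (star b); first exact: Cs.
  by rewrite -starB cnorm_star.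
apply/cstar_closedP => a ha e e0; have e2 : 0 < e / 2 by rewrite divr_gt0.
have [b hb eb] := ha _ e2; have [c Cc ec] := hb _ e2; exists c => //.
by rewrite (le_trans (cnorm_dist_triangle b _ _)) //; lra.
Qed.

End Generated.

(** * Consequences of the relations: [phi], the transfer map and words *)

Section Relations.
Variables (R : realType) (A : cstarAlgType R) (u s : A).
Hypothesis rel : Q2_relations u s.
Implicit Types (a b c f h x y z : A).

Let B : set A := cstar_gen [set u].

Lemma unitaryK : star u * u = 1. Proof. by case: rel => [[]]. Qed.
Lemma unitaryKV : u * star u = 1. Proof. by case: rel => [[]]. Qed.
Lemma isometryK : star s * s = 1. Proof. by case: rel. Qed.
Lemma s_u : s * u = u ^+ 2 * s. Proof. by case: rel. Qed.
Lemma range_sum : s * star s + u * s * star s * star u = 1. Proof. by case: rel. Qed.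

Lemma cnorm_u : cnorm u <= 1. Proof. exact: cnorm_isometry unitaryK. Qed.
Lemma cnorm_s : cnorm s <= 1. Proof. exact: cnorm_isometry isometryK. Qed.

(** Compressing the range relation by [s] gives 1 + x x^* = 1 for x = s^* u s. *)
Lemma ranges_orthogonal : star s * u * s = 0.
Proof.
have := congr1 (fun x => star s * x * s) range_sum.
rewrite mulrDr mulrDl mulr1 isometryK !mulrA isometryK mul1r isometryK.
move=> /eqP; rewrite -subr_eq0 addrAC subrr add0r => /eqP h.
have : star (star (star s * u * s)) * star (star s * u * s) = 0.
  by rewrite starK !starM starK !mulrA.
by move/starM_eq0/(congr1 star); rewrite starK star0.
Qed.

Lemma ranges_orthogonalV : star s * star u * s = 0.
Proof. by have := congr1 star ranges_orthogonal; rewrite !starM starK star0 mulrA. Qed.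

Lemma u_starK a : star u * (u * a) = a. Proof. by rewrite mulrA unitaryK mul1r. Qed.
Lemma u_starKV a : u * (star u * a) = a. Proof. by rewrite mulrA unitaryKV mul1r. Qed.
Lemma s_starK a : star s * (s * a) = a. Proof. by rewrite mulrA isometryK mul1r. Qed.
Lemma sus0 a : star s * (u * (s * a)) = 0.
Proof. by rewrite !mulrA ranges_orthogonal mul0r. Qed.
Lemma susV0 a : star s * (star u * (s * a)) = 0.
Proof. by rewrite !mulrA ranges_orthogonalV mul0r. Qed.

Lemma B_subalgebra : cstar_subalgebra B. Proof. exact: cstar_gen_subalgebra. Qed.
Lemma BD a b : B a -> B b -> B (a + b). Proof. by case: B_subalgebra => _ h *; apply: h. Qed.
Lemma BZ (z : R[i]) a : B a -> B (z *: a). Proof. by case: B_subalgebra => _ _ h *; apply: h. Qed.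
Lemma BM a b : B a -> B b -> B (a * b). Proof. by case: B_subalgebra => _ _ _ h *; apply: h. Qed.
Lemma Bstar a : B a -> B (star a). Proof. by case: B_subalgebra => _ _ _ _ [h _]; apply: h. Qed.
Lemma B_closed : approx_closed B.
Proof. by case: B_subalgebra => _ _ _ _ [_ /cstar_closedP]. Qed.
Lemma B0 : B 0. Proof. by case: B_subalgebra. Qed.
Lemma Bu : B u. Proof. exact: cstar_gen_self. Qed.
Lemma B1 : B 1. Proof. by rewrite -unitaryK; apply: BM; [apply: Bstar|]; apply: Bu. Qed.
Lemma BB a b : B a -> B b -> B (a - b).
Proof. by move=> ha hb; apply: BD => //; rewrite -scaleN1r; apply: BZ. Qed.
Lemma BX a n : B a -> B (a ^+ n).
Proof. by move=> ha; elim: n => [|n IH]; rewrite ?expr0 ?exprS; [apply: B1 | apply: BM]. Qed.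

Lemma B_ind C : cstar_subalgebra C -> C u -> B `<=` C.
Proof. by move=> hC Cu; apply: cstar_gen_min => // x ->. Qed.

Lemma B_comm_u b : B b -> u * b = b * u.
Proof.
move=> /(B_ind (cstar_subalgebra_commutant [set u]))/= h; apply: (h _ u _).1 => //.
by move=> a ->; rewrite unitaryK unitaryKV.
Qed.

Lemma B_comm a b : B a -> B b -> a * b = b * a.
Proof.
move=> ha /(B_ind (cstar_subalgebra_commutant B))/= h; apply: (h _ a ha).1.
move=> c Bc; rewrite -(B_comm_u Bc); split=> //.
by rewrite -(B_comm_u (Bstar Bc)).
Qed.

(** On C^*(u) this is the endomorphism f(z) -> f(z^2); the two summands live on the orthogonal
    ranges of [s] and [u * s]. *)
Definition phi b : A := s * b * star s + u * s * b * star s * star u.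

Lemma phiD a b : phi (a + b) = phi a + phi b.
Proof. by rewrite /phi !mulrDr !mulrDl addrACA. Qed.

Lemma phiZ (z : R[i]) b : phi (z *: b) = z *: phi b.
Proof. by rewrite /phi -!scalerAr -!scalerAl -scalerDr. Qed.

Lemma phiM a b : phi (a * b) = phi a * phi b.
Proof.
rewrite /phi mulrDl !mulrDr -!mulrA s_starK sus0 u_starK s_starK susV0.
by rewrite !mulr0 addr0 add0r.
Qed.

Lemma phi_star b : phi (star b) = star (phi b).
Proof. by rewrite /phi starD !starM !starK !mulrA. Qed.

Lemma phi_u : phi u = u ^+ 2.
Proof.
have uu2 : u * u ^+ 2 = u ^+ 2 * u by rewrite -exprS exprSr.
rewrite /phi -(mulrA u s u) s_u [u * (_ * s)]mulrA uu2 -!mulrA -!mulrDr.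
by have := range_sum; rewrite -!mulrA => ->; rewrite mulr1.
Qed.

Lemma s_phi b : s * b = phi b * s.
Proof.
have e : star s * (star u * s) = 0 by rewrite mulrA ranges_orthogonalV.
by rewrite /phi mulrDl -!mulrA isometryK e !mulr0 addr0 mulr1.
Qed.

Lemma sstar_phi b : b * star s = star s * phi b.
Proof. by have := congr1 star (s_phi (star b)); rewrite phi_star !starM !starK. Qed.

Lemma sX_phi n b : s ^+ n * b = iter n phi b * s ^+ n.
Proof.
elim: n => [|n IH]; first by rewrite !expr0 mul1r mulr1.
by rewrite exprS -mulrA IH mulrA s_phi iterS mulrA.
Qed.

Lemma sstarX_phi n b : b * star s ^+ n = star s ^+ n * iter n phi b.
Proof.
elim: n => [|n IH]; first by rewrite !expr0 mul1r mulr1.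
by rewrite exprSr mulrA IH -mulrA sstar_phi iterS mulrA.
Qed.

Lemma cnorm_contract x y a : cnorm x <= 1 -> cnorm y <= 1 -> cnorm (x * a * y) <= cnorm a.
Proof.
move=> x1 y1; rewrite (le_trans (cnormM _ _)) // (@le_trans _ _ (cnorm (x * a))) //.
  by rewrite ler_piMr ?cnorm_ge0.
by rewrite (le_trans (cnormM _ _)) // ler_piMl ?cnorm_ge0.
Qed.

Lemma B_phi b : B b -> B (phi b).
Proof.
apply: (@B_ind [set x | B (phi x)]); last by rewrite /= phi_u; apply: BX Bu.
apply: (@cstar_subalgebra_pullback _ _ phi 2).
- exact: B_subalgebra.
- by rewrite /phi !(mulr0, mul0r) addr0.
- exact: phiD.
- exact: phiZ.
- exact: phiM.
- exact: phi_star.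
move=> a; have us1 : cnorm (u * s) <= 1 by apply: cnorm_le1M; [apply: cnorm_u | apply: cnorm_s].
have h1 : cnorm (s * a * star s) <= cnorm a by apply: cnorm_contract; rewrite ?cnorm_star cnorm_s.
have h2 : cnorm (u * s * a * star (u * s)) <= cnorm a by apply: cnorm_contract; rewrite ?cnorm_star.
have -> : phi a = s * a * star s + u * s * a * star (u * s) by rewrite /phi starM !mulrA.
by rewrite (le_trans (cnormD _ _)) //; lra.
Qed.

Lemma B_phiX n b : B b -> B (iter n phi b).
Proof. by move=> Bb; elim: n => //= n; apply: B_phi. Qed.

(* The matrix entries [s^* u^-i b u^j s], i, j in {0, 1}, of a product are given
   by the matrix product, so those b whose entries are all in B form an algebra. *)
Lemma B_transfer b : B b -> B (star s * b * s).
Proof.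
pose e (i : bool) : A := if i then u else 1.
pose m i j x := star s * star (e i) * x * (e j * s).
pose C := [set x | forall i j, B (m i j x)].
suff BC : B `<=` C.
  by move=> /BC /(_ false false); rewrite /m /e star1 mulr1 mul1r.
have mM i j x y : m i j (x * y) = m i false x * m false j y + m i true x * m true j y.
  rewrite /m /= star1 mulr1 mul1r -[x in LHS]mulr1 -range_sum.
  by rewrite !(mulrDr, mulrDl) !mulrA.
have mD i j x y : m i j (x + y) = m i j x + m i j y by rewrite /m mulrDr mulrDl.
have mZ i j (z : R[i]) x : m i j (z *: x) = z *: m i j x.
  by rewrite /m -scalerAr -scalerAl.
have mle i j x : cnorm (m i j x) <= cnorm x.
  apply: cnorm_contract; apply: cnorm_le1M; rewrite ?cnorm_star ?cnorm_s //.
    by case: i; rewrite /= ?cnorm_u ?cnorm1_le1.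
  by case: j; rewrite /= ?cnorm_u ?cnorm1_le1.
apply: B_ind; last first.
  (* The matrix of [u] has zero diagonal and off-diagonal entries [1] and [u]. *)
  rewrite /C /= => [[] []]; rewrite /m /= ?star1 ?mulr1 ?mul1r -?mulrA.
  - by rewrite u_starK mulrA ranges_orthogonal; apply: B0.
  - by rewrite u_starK isometryK; apply: B1.
  - by rewrite [u * (u * s)]mulrA -expr2 -s_u s_starK; apply: Bu.
  - by rewrite mulrA ranges_orthogonal; apply: B0.
split; rewrite /C /=.
- by move=> i j; rewrite /m mulr0 mul0r; apply: B0.
- by move=> x y hx hy i j; rewrite mD; apply: BD.
- by move=> z x hx i j; rewrite mZ; apply: BZ.
- by move=> x y hx hy i j; rewrite mM; apply: BD; apply: BM.
split=> [x hx i j|].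
  have -> : m i j (star x) = star (m j i x) by rewrite /m !starM !starK !mulrA.
  exact: Bstar.
apply/cstar_closedP => x hx i j; apply: (@approx_closed_lip _ _ (m i j) 1 B) => [a c| |].
- have -> : m i j a - m i j c = m i j (a - c) by rewrite mD -[- c]scaleN1r mZ scaleN1r.
  by rewrite mul1r.
- exact: B_closed.
by move=> d /hx [y hy]; exists y => //; apply: hy.
Qed.

Lemma B_transferX n x : B x -> B (star s ^+ n * x * s ^+ n).
Proof.
elim: n x => [|n IH] x Bx; first by rewrite !expr0 mul1r mulr1.
by have := IH _ (B_transfer Bx); rewrite exprSr exprS !mulrA.
Qed.

Lemma starX a n : star (a ^+ n) = star a ^+ n.
Proof. by elim: n => [|n IH]; rewrite ?expr0 ?star1 // exprS starM IH exprSr. Qed.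

(** Coefficients on both sides absorb scalars and the zero sum, and make the span visibly stable
    under [star]. *)
Inductive word_span : A -> Prop :=
| word_span_word p q b c : B b -> B c -> word_span (b * s ^+ p * star s ^+ q * c)
| word_spanD x y : word_span x -> word_span y -> word_span (x + y).

Lemma word_spanZ (z : R[i]) x : word_span x -> word_span (z *: x).
Proof.
elim=> [p q b c Bb Bc|{}x y _ hx _ hy]; last by rewrite scalerDr; apply: word_spanD.
by rewrite !scalerAl; apply: word_span_word => //; apply: BZ.
Qed.

Lemma word_span_star x : word_span x -> word_span (star x).
Proof.
elim=> [p q b c Bb Bc|{}x y _ hx _ hy]; last by rewrite starD; apply: word_spanD.
by rewrite !starM !starX starK !mulrA; apply: word_span_word; apply: Bstar.
Qed.

(** The smaller of [q] and [p'] cancels: [B_transferX] turns the middle into [y] in [B], and [phi]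
    carries [y] to the left through [s ^+ p] or to the right through [star s ^+ q']. *)
Lemma word_mul p q b c p' q' b' c' : B b -> B c -> B b' -> B c' ->
  word_span ((b * s ^+ p * star s ^+ q * c) * (b' * s ^+ p' * star s ^+ q' * c')).
Proof.
move=> Bb Bc Bb' Bc'; have Bx : B (c * b') by apply: BM.
have [qp|/ltnW pq] := leqP q p'.
  set y := star s ^+ q * (c * b') * s ^+ q; have By : B y by apply: B_transferX.
  have -> : b * s ^+ p * star s ^+ q * c * (b' * s ^+ p' * star s ^+ q' * c') =
      (b * iter p phi y) * s ^+ (p + (p' - q)) * star s ^+ q' * c'.
    rewrite exprD -{1}(subnKC qp) exprD !mulrA; do 3 congr (_ * _).
    by rewrite -[RHS]mulrA -sX_phi /y !mulrA.
  by apply: word_span_word => //; apply: BM => //; apply: B_phiX.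
set y := star s ^+ p' * (c * b') * s ^+ p'; have By : B y by apply: B_transferX.
have -> : b * s ^+ p * star s ^+ q * c * (b' * s ^+ p' * star s ^+ q' * c') =
    b * s ^+ p * star s ^+ ((q - p') + q') * (iter q' phi y * c').
  rewrite exprD -{1}(subnK pq) exprD !mulrA; congr (_ * _).
  by rewrite -[RHS]mulrA -sstarX_phi /y !mulrA.
by apply: word_span_word => //; apply: BM => //; apply: B_phiX.
Qed.

Lemma word_spanM x y : word_span x -> word_span y -> word_span (x * y).
Proof.
move=> hx; elim=> [p q b c Bb Bc|{}y z _ hy _ hz]; last by rewrite mulrDr; apply: word_spanD.
elim: hx => [p' q' b' c' Bb' Bc'|{}x z _ hx _ hz]; last by rewrite mulrDl; apply: word_spanD.
exact: word_mul.
Qed.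

Lemma word_span_B b : B b -> word_span b.
Proof.
move=> Bb; have := @word_span_word 0 0 b 1 Bb B1.
by rewrite !expr0 !mulr1.
Qed.

Lemma word_span_s : word_span s.
Proof.
have := @word_span_word 1 0 1 1 B1 B1.
by rewrite expr0 expr1 !mulr1 mul1r.
Qed.

Hypothesis gen : cstar_gen [set u; s] = setT.

Lemma word_span_dense (a : A) (e : R) : 0 < e -> exists2 w, word_span w & cnorm (w - a) <= e.
Proof.
suff h : [set: A] `<=`
    [set a : A | forall e : R, 0 < e -> exists2 b, word_span b & cnorm (b - a) <= e].
  by apply: h.
rewrite -gen; apply: cstar_gen_min => [|x].
  apply: cstar_subalgebra_closure.
  - exact: word_span_B B0.
  - by move=> ? ?; apply: word_spanD.
  - by move=> ? ?; apply: word_spanZ.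
  - by move=> ? ?; apply: word_spanM.
  - exact: word_span_star.
have dense y : word_span y -> forall e : R, 0 < e -> exists2 b, word_span b & cnorm (b - y) <= e.
  by move=> hy d d0; exists y => //; rewrite subrr cnorm0 ltW.
by case=> ->; apply: dense; [apply: word_span_B Bu | apply: word_span_s].
Qed.

End Relations.

(** * Rotations and regularity *)

Section Rotations.
Variables (R : realType) (A : cstarAlgType R) (u s : A).
Hypothesis rel : Q2_relations u s.
Implicit Types (a b c f h x y z : A).

Let B : set A := cstar_gen [set u].

Lemma sstar_u : star s * u = u * (star s * star u).
Proof.
have e : star u * star s = star s * (star u * star u).
  by have := congr1 star (s_u rel); rewrite expr2 !starM.
have := congr1 (fun x => u * x * u) e.
by rewrite (u_starKV rel) -!mulrA (unitaryK rel) mulr1.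
Qed.

(** In the 2 by 2 matrix picture given by [s] and [u * s], this is diag(V, c V), while [u] has
    off-diagonal entries [u] and [1]. Hence the new twist [c] is a square root of the old one. *)
Definition rotation_step (c : R[i]) (V : A) : A :=
  s * V * star s + c *: (u * s * V * star s * star u).

Lemma rotation_stepP (c z : R[i]) V : c * c^* = 1 -> c ^+ 2 = z ->
  cstar_unitary V -> V * u = z *: (u * V) ->
  cstar_unitary (rotation_step c V) /\
  rotation_step c V * u = c *: (u * rotation_step c V).
Proof.
move=> cc cz [VV VV'] Vu; have starW : star (rotation_step c V) =
    s * star V * star s + c^* *: (u * s * star V * star s * star u).
  by rewrite starD starZ !starM !starK !mulrA.
have prod X Y p q : (s * X * star s + p *: (u * s * X * star s * star u)) *
    (s * Y * star s + q *: (u * s * Y * star s * star u)) =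
    s * (X * Y) * star s + (p * q) *: (u * s * (X * Y) * star s * star u).
  rewrite mulrDl !mulrDr -!scalerAl -!scalerAr scalerA -!mulrA.
  rewrite !(s_starK rel) (sus0 rel) (u_starK rel) (s_starK rel) (susV0 rel).
  by rewrite !mulr0 !scaler0 addr0 add0r.
split; first split.
- by rewrite starW /rotation_step prod VV mulrC cc scale1r !mulr1 range_sum.
- by rewrite starW /rotation_step prod VV' cc scale1r !mulr1 range_sum.
rewrite /rotation_step mulrDl mulrDr scalerDr -!scalerAl -!scalerAr scalerA -expr2 cz.
rewrite addrC -!mulrA (unitaryK rel) mulr1 sstar_u; congr (_ + _).
rewrite (mulrA V u) Vu -scalerAl -scalerAr; congr (_ *: _).
by rewrite -mulrA (mulrA s u) (s_u rel) expr2 -!mulrA.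
Qed.

Let w := dyadic_root R.

(** Unitaries implementing u -> w_n u, whence the invariance of the spectrum of [u] under dyadic
    rotations. The recursion starts from [1], whose twist is 1 = (-1)^2. *)
Fixpoint rotation n : A :=
  if n is n'.+1 then rotation_step (w n) (rotation n') else rotation_step (w 0) 1.

Lemma rotationP n : cstar_unitary (rotation n) /\
  rotation n * u = w n *: (u * rotation n).
Proof.
elim: n => [|n [IH1 IH2]].
  apply: (@rotation_stepP (w 0) 1); first exact: dyadic_root_unit.
  - by rewrite /w dyadic_root0 sqrrN expr1n.
  - by split; rewrite star1 mulr1.
  - by rewrite scale1r mul1r mulr1.
by apply: (@rotation_stepP (w n.+1) (w n)); [apply: dyadic_root_unit | apply: dyadic_rootS | |].
Qed.

(** True for [u] as w_n tends to 1. Commutators are derivations and [rotation n] is unitary, so the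
    elements with this property form a C*-subalgebra. *)
Lemma rotation_asymp_comm b : B b -> tends (fun n => rotation n * b - b * rotation n) 0.
Proof.
pose V n := rotation n; pose K n x := V n * x - x * V n.
have VP n : star (V n) * V n = 1 /\ V n * star (V n) = 1 by have [] := rotationP n.
have V1 n : cnorm (V n) <= 1 by have [h _] := VP n; apply: cnorm_isometry.
have KD n x y : K n (x + y) = K n x + K n y.
  by rewrite /K mulrDr mulrDl opprD addrACA.
have KZ n (z : R[i]) x : K n (z *: x) = z *: K n x.
  by rewrite /K -scalerAr -scalerAl scalerBr.
have KM n x y : K n (x * y) = 1 * K n x * y + x * K n y * 1.
  by rewrite /K mul1r mulr1 mulrBl mulrBr !mulrA addrA subrK.
have Kstar n x : K n (star x) = V n * star (K n x) * V n.
  have [h1 h2] := VP n; rewrite /K starB !starM mulrBr mulrBl -!mulrA h1 mulr1.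
  by rewrite (mulrA (V n) (star _)) h2 mul1r.
have Kle n x : cnorm (K n x) <= 2 * cnorm x.
  rewrite (le_trans (cnormB _ _)) //; have := cnormM (V n) x; have := cnormM x (V n).
  by have := V1 n; have := cnorm_ge0 x; nra.
apply: (@B_ind _ _ u [set x | tends (K ^~ x) 0]); last first.
  move=> e /(@root_gap_lim R) [N hN]; exists N => n /hN; apply: le_trans.
  have [_ Vu] := rotationP n.
  have -> : K n u - 0 = (w n - 1) *: (u * V n) by rewrite subr0 /K Vu scalerBl scale1r.
  rewrite cnormZ -[leRHS]mulr1 ler_wpM2l //; first exact: (@root_gap_ge0 R).
  by apply: cnorm_le1M => //; apply: cnorm_u rel.
split=> /=.
- apply: (tends_near (k := 0)) (tends_const 0) => n _.
  by rewrite /K mulr0 mul0r subrr.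
- move=> x y hx hy; rewrite -[0]addr0.
  by apply: (tends_near (k := 0)) (tendsD hx hy) => n _; rewrite KD.
- move=> z x hx; rewrite -(scaler0 _ z).
  by apply: (tends_near (k := 0)) (tendsZ z hx) => n _; rewrite KZ.
- move=> x y hx hy; have := tendsD (tends_MM 1 y hx) (tends_MM x 1 hy).
  by rewrite !mulr0 !mul0r addr0; apply: (tends_near (k := 0)) => n _; rewrite KM.
split=> [x hx e /hx [N hN]|].
  exists N => n /hN; rewrite !subr0 Kstar; apply: le_trans.
  by rewrite -(cnorm_star (K n x)); apply: cnorm_contract.
apply/cstar_closedP => x hx e e0; have e4 : 0 < e / 4 by rewrite divr_gt0.
have [y hy xy] := hx _ e4; have [N hN] := hy _ e4; exists N => n /hN.
have -> : K n x = K n y - K n (y - x).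
  by rewrite KD -[- x]scaleN1r KZ scaleN1r opprD addrA subrr add0r opprK.
rewrite !subr0; have := cnormB (K n y) (K n (y - x)); have := Kle n (y - x).
by have := cnorm_ge0 (K n y); lra.
Qed.

Lemma rotationX n k : rotation n * u ^+ k = w n ^+ k *: (u ^+ k * rotation n).
Proof.
have [_ Vu] := rotationP n; elim: k => [|k IH]; first by rewrite !expr0 scale1r mul1r mulr1.
rewrite [u ^+ _]exprSr mulrA IH -scalerAl -[_ * rotation n * u]mulrA Vu.
by rewrite -scalerAr scalerA [w n ^+ k.+1]exprSr mulrA.
Qed.

(* [b] lives over the k-th roots of unity, which a small dyadic rotation V makes
   disjoint from themselves, so that [b^* V b = 0] while [V b] is close to [b V]. *)
Lemma B_torsion_free k b : (0 < k)%N -> B b -> u ^+ k * b = b -> b = 0.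
Proof.
move=> k0 Bb ub; have bu : star b * u ^+ k = star b.
  have uk : star (u ^+ k) * u ^+ k = 1.
    elim: k {k0 ub} => [|k IH]; first by rewrite expr0 star1 mulr1.
    by rewrite exprS starM -mulrA (u_starK rel).
  by rewrite -{1}ub starM -mulrA uk mulr1.
apply: cnorm_small => e e0.
have [N1 hN1] := dyadic_root_neq1 R k0.
have [N2 hN2] := rotation_asymp_comm Bb e0.
pose n := maxn N1 N2; have wn : w n ^+ k <> 1 by apply: hN1; apply: leq_maxl.
have := hN2 n (leq_maxr _ _); rewrite subr0 => hV.
have [[_ VV] _] := rotationP n.
have bVb : star b * rotation n * b = 0.
  (* Moving [u ^+ k] from the right factor to the left one costs w_n^k, which differs from 1. *)
  have h : star b * rotation n * b = w n ^+ k *: (star b * rotation n * b).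
    rewrite -[X in _ * X = _]ub mulrA -[_ * u ^+ k]mulrA rotationX -scalerAr -scalerAl.
    by rewrite !mulrA bu.
  have : (1 - w n ^+ k) *: (star b * rotation n * b) = 0 by rewrite scalerBl scale1r -h subrr.
  move/eqP; rewrite scaler_eq0 subr_eq0 => /orP[/eqP/esym //|/eqP //].
have : cnorm b ^+ 2 <= cnorm b * e.
  have -> : cnorm b ^+ 2 = cnorm (star b * (b * rotation n - rotation n * b) * star (rotation n)).
    by rewrite mulrBr [star b * (_ * b)]mulrA bVb subr0 -!mulrA VV mulr1 cnorm_starM.
  rewrite (le_trans (cnormM _ _)) // -[leRHS]mulr1 ler_pM ?cnorm_ge0 //.
    rewrite (le_trans (cnormM _ _)) // cnorm_star ler_wpM2l ?cnorm_ge0 //.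
    by rewrite cnorm_distC.
  by rewrite cnorm_star; have [[h _] _] := rotationP n; apply: cnorm_isometry.
by have := cnorm_ge0 b; nra.
Qed.

End Rotations.

(** * Regularity: normalizers of the form [f * s] *)

Section Regularity.
Variables (R : realType) (A : cstarAlgType R) (u s : A).
Hypothesis rel : Q2_relations u s.
Implicit Types (a b c f h x y z : A).

Let B : set A := cstar_gen [set u].

(** The self-adjoint unitary implementing u -> -u, that is, [rotation 0] in closed form. *)
Definition flip : A := s * star s - u * s * star s * star u.

Lemma flip_u : flip * u = - (u * flip).
Proof.
rewrite /flip mulrBl mulrBr opprB; congr (_ - _); last first.
  by rewrite -[_ * star u * u]mulrA (unitaryK rel) mulr1 !mulrA.
rewrite -!mulrA (sstar_u rel) !mulrA (s_u rel) expr2 -!mulrA; congr (_ * _).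
Qed.

Lemma flip_sa : self_adjoint flip.
Proof. by rewrite /self_adjoint starB !starM !starK !mulrA. Qed.

Lemma flip_ustar : flip * star u = - (star u * flip).
Proof.
have := congr1 star flip_u; rewrite starN !starM flip_sa => /(congr1 (@GRing.opp _)).
by rewrite opprK.
Qed.

Lemma range_proj_flip : s * star s = 2^-1 *:: (1 + flip).
Proof. by rewrite -(range_sum rel) /flip addrACA subrr addr0 scalerDr scale_halfD. Qed.

(** Only the range projection s s^* = (1 + flip)/2 could lead out of [B], and the hypothesis removes
    its [flip] half. *)
Lemma normalizer_corner f : B f -> f * flip * star f = 0 -> cstar_normalizer B (f * s).
Proof.
move=> Bf fVf; split=> b Bb.
  have -> : f * s * b * star (f * s) = phi u s b * (f * (s * star s) * star f).
    rewrite starM -(mulrA f s b) (s_phi rel) !mulrA.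
    by rewrite (B_comm rel Bf (B_phi rel Bb)).
  apply: BM; first exact: (B_phi rel Bb).
  rewrite range_proj_flip -scalerAr -scalerAl mulrDr mulrDl fVf addr0 mulr1.
  by apply: BZ; apply: BM => //; apply: Bstar.
have -> : star (f * s) * b * (f * s) = star s * (star f * b * f) * s.
  by rewrite starM !mulrA.
by apply: (B_transfer rel); apply: BM => //; apply: BM => //; apply: Bstar.
Qed.

(** For p = |h|, [flip] commutes with [p] and so exchanges p + h and p - h, whose product is 0.
    Hence h (p + h) s and h (p - h) s are normalizers, and they differ by 2 h^2 s. *)
Lemma regular_anti h : self_adjoint h -> B h -> flip * h = - (h * flip) ->
  cstar_gen (cstar_normalizer B) (h * h * s).
Proof.
move=> hs Bh Vh; have [|p [/pos_sa ps pE pC]] := @pos_sqrt _ _ (h * h); first by exists h.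
have Bp : B p.
  apply: (pC B); last exact: BM.
  by apply: square_closed_subalgebra (B1 rel); apply: B_subalgebra.
have Vp : flip * p = p * flip.
  apply: (pC _ (square_closed_commutant flip)) => /=.
  by rewrite mulrA Vh mulNr -[h * flip * h]mulrA Vh mulrN opprK mulrA.
have hp : h * p = p * h := B_comm rel Bh Bp.
have corner g1 g2 : self_adjoint g1 -> B g1 -> flip * g1 = g2 * flip -> g1 * g2 = 0 ->
    cstar_normalizer B (h * g1 * s).
  move=> g1s Bg1 Vg g12; apply: normalizer_corner; first exact: BM.
  rewrite starM hs g1s !mulrA -(mulrA _ flip) Vg mulrA -(mulrA h) g12.
  by rewrite mulr0 !mul0r.
have nP : cstar_normalizer B (h * (p + h) * s).
  apply: (corner _ (p - h)); first by rewrite /self_adjoint starD hs ps.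
  - exact: BD.
  - by rewrite mulrDr [(p - h) * _]mulrBl Vp Vh.
  - by rewrite mulrDl !mulrBr -pE hp addrA subrK subrr.
have nM : cstar_normalizer B (h * (p - h) * s).
  apply: (corner _ (p + h)); first by rewrite /self_adjoint starB hs ps.
  - exact: BB.
  - by rewrite mulrBr [(p + h) * _]mulrDl Vp Vh opprK.
  - by rewrite mulrBl !mulrDr -pE hp opprD addrA addrK subrr.
have -> : h * h * s = 2^-1 *:: (h * (p + h) * s + (-1) *: (h * (p - h) * s)).
  rewrite scaleN1r -mulrBl -mulrBr.
  have -> : p + h - (p - h) = h + h by rewrite opprB addrC addrA subrK.
  by rewrite mulrDr mulrDl scalerDr scale_halfD.
case: (cstar_gen_subalgebra (cstar_normalizer B)) => _ gD gZ _ _.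
apply: (gZ); apply: (gD); first exact: cstar_gen_self.
by apply: (gZ); apply: cstar_gen_self.
Qed.

Hypothesis gen : cstar_gen [set u; s] = setT.

Lemma B_regular : cstar_regular B.
Proof.
rewrite /cstar_regular -subTset -gen; apply: cstar_gen_min; first exact: cstar_gen_subalgebra.
have Bu' := @Bu _ _ u; have Bus := Bstar Bu'.
move=> x [] ->.
  by apply: cstar_gen_self; split=> b Bb; apply: BM => //; apply: BM.
(* As [u] is unitary, the squares of its real and imaginary parts sum to 1; both parts anticommute
   with [flip]. *)
have -> : s = re_part u * re_part u * s + im_part u * im_part u * s.
  rewrite -mulrDl re_sqr_im_sqr (unitaryK rel) (unitaryKV rel) scalerDr scale_halfD.
  by rewrite mul1r.
case: (cstar_gen_subalgebra (cstar_normalizer B)) => _ gD _ _ _.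
apply: (gD); apply: regular_anti.
- exact: re_part_sa.
- by apply: BZ; apply: BD.
- by rewrite -scalerAl -scalerAr mulrDr [(u + star u) * _]mulrDl flip_u flip_ustar -opprD scalerN.
- exact: im_part_sa.
- by apply: BZ; apply: BB.
- rewrite -scalerAl -scalerAr mulrBr [(u - star u) * _]mulrBl flip_u flip_ustar.
  by rewrite -opprB opprK addrC scalerN.
Qed.

End Regularity.

(** * The conditional expectation *)

Section Expectation.
Variables (R : realType) (A : cstarAlgType R) (u s : A).
Hypotheses (rel : Q2_relations u s) (gen : cstar_gen [set u; s] = setT).
Implicit Types (a b c f h x y z : A).

Let B : set A := cstar_gen [set u].
Let w := dyadic_root R.

Variable gauge : nat -> A -> A.
Hypotheses (gaugeD : forall i a b, gauge i (a + b) = gauge i a + gauge i b)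
  (gaugeZ : forall i (z : R[i]) a, gauge i (z *: a) = z *: gauge i a)
  (gaugeM : forall i a b, gauge i (a * b) = gauge i a * gauge i b)
  (gauge_star : forall i a, gauge i (star a) = star (gauge i a))
  (gauge_le : forall i a, cnorm (gauge i a) <= cnorm a)
  (gauge_u : forall i, gauge i u = u) (gauge_s : forall i, gauge i s = w i *: s).

Lemma gauge_pos i a : pos a -> pos (gauge i a).
Proof.
by move=> [k ks ->]; exists (gauge i k); rewrite ?gaugeM // /self_adjoint -gauge_star ks.
Qed.

Lemma gauge_B i b : B b -> gauge i b = b.
Proof.
have g0 : gauge i 0 = 0 by rewrite -(scale0r 0) gaugeZ !scale0r.
apply: (@B_ind _ _ u [set x | gauge i x = x]); last exact: gauge_u.
split=> /= [|a c ha hc|z a ha|a c ha hc|]; first exact: g0.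
- by rewrite gaugeD ha hc.
- by rewrite gaugeZ ha.
- by rewrite gaugeM ha hc.
split=> [a ha|]; first by rewrite gauge_star ha.
apply/cstar_closedP => a ha; apply/eqP; rewrite -subr_eq0; apply/eqP.
apply: cnorm_small => e e0; have [|c hc ac] := ha (e / 2); first by rewrite divr_gt0.
have -> : gauge i a - a = gauge i (a - c) + (c - a).
  by rewrite gaugeD -[- c]scaleN1r gaugeZ hc scaleN1r addrA subrK.
rewrite (le_trans (cnormD _ _)) //; have := gauge_le i (a - c).
by rewrite (cnorm_distC a); lra.
Qed.

Lemma gaugeX i a n : gauge i (a ^+ n) = gauge i a ^+ n.
Proof.
by elim: n => [|n IH]; rewrite ?expr0 ?(gauge_B _ (B1 rel)) // !exprS gaugeM IH.
Qed.

Lemma gauge_word i p q b c : B b -> B c ->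
  gauge i (b * s ^+ p * star s ^+ q * c) =
  (w i ^+ p * (w i)^* ^+ q) *: (b * s ^+ p * star s ^+ q * c).
Proof.
move=> Bb Bc; rewrite !gaugeM !gaugeX gauge_star gauge_s starZ !exprZn !gauge_B //.
by rewrite -!scalerAr -!scalerAl scalerA mulrC.
Qed.

Lemma slow_word p q b c : B b -> B c -> slow gauge (b * s ^+ p * star s ^+ q * c).
Proof.
move=> Bb Bc; set x := _ * c; pose K := (p + q)%:R * cnorm x.
have K0 : 0 <= K by rewrite mulr_ge0 ?ler0n ?cnorm_ge0.
(* Each drop of [root_gap] is at least a quarter of its value, hence the factor 4. *)
apply: (slow_telescope gaugeD gaugeZ gauge_le (d := fun i => 4 * K * root_gap R i)).
- exists 0%N => i _; rewrite gauge_word // -/x.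
  have -> : (w i ^+ p * (w i)^* ^+ q) *: x - x = (w i ^+ p * (w i)^* ^+ q - 1) *: x.
    by rewrite scalerBl scale1r.
  rewrite cnormZ.
  have h1 := normc_unit_pow p q (normc_dyadic_root R i) (dyadic_root_unit R i).
  have := ler_wpM2r (cnorm_ge0 x) h1; rewrite -/(root_gap R i) mulrAC -/K -/w => h2.
  apply: le_trans h2 _; have := ler_wpM2l K0 (root_gapS R i); lra.
- by move=> i; apply: mulr_ge0; [apply: mulr_ge0; rewrite ?ler0n | apply: root_gap_ge0].
move=> e e0; have K1 : 0 < 4 * K + 1 by rewrite ltr_wpDl // mulr_ge0 ?ler0n.
have [|N hN] := @root_gap_lim R (e / (4 * K + 1)); first by rewrite divr_gt0.
exists N => n /hN; rewrite ler_pdivlMr //; have := root_gap_ge0 R n; nra.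
Qed.

Lemma slow_gauge a : slow gauge a.
Proof.
apply: (approx_closed_slow gaugeD gaugeZ gauge_le) => e e0.
have [x hx ax] := word_span_dense rel gen a e0; exists x => //=.
elim: hx {ax} => [p q b c Bb Bc|{}x y _ hx _ hy]; first exact: slow_word.
exact: slowD.
Qed.

Lemma gauge_lim_ex a : exists l, tends (fun n => avg gauge 0 n a) l.
Proof. by apply: slow_lim => //; apply: slow_gauge. Qed.

Definition gauge_mean : A -> A := projT1 (choice gauge_lim_ex).

Lemma gauge_meanP a : tends (fun n => avg gauge 0 n a) (gauge_mean a).
Proof. exact: (projT2 (choice gauge_lim_ex)). Qed.

Lemma gauge_meanD a b : gauge_mean (a + b) = gauge_mean a + gauge_mean b.
Proof.
apply: (tends_uniq (gauge_meanP (a + b))).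
by apply: (tends_near (k := 0)) (tendsD (gauge_meanP a) (gauge_meanP b)) => n _; rewrite avgD.
Qed.

Lemma gauge_meanZ (z : R[i]) a : gauge_mean (z *: a) = z *: gauge_mean a.
Proof.
apply: (tends_uniq (gauge_meanP (z *: a))).
by apply: (tends_near (k := 0)) (tendsZ z (gauge_meanP a)) => n _; rewrite avgZ.
Qed.

Lemma gauge_mean_le a : cnorm (gauge_mean a) <= cnorm a.
Proof. by apply: tends_cnorm_le (gauge_meanP a) => n; apply: avg_le. Qed.

Lemma gauge_mean_pos a : pos a -> pos (gauge_mean a).
Proof.
move=> pa; apply: (approx_lim (@approx_closed_pos _ A) _ (gauge_meanP a)) => n /=.
by apply: avg_pos => // i x; apply: gauge_pos.
Qed.

Lemma gauge_mean_faithful a : pos a -> gauge_mean a = 0 -> a = 0.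
Proof.
move=> pa a0; apply: (avg_lim_faithful gauge_pos (slow_gauge a) pa) => //.
by rewrite -a0; apply: gauge_meanP.
Qed.

Lemma gauge_mean_bimodule b a c : B b -> B c -> gauge_mean (b * a * c) = b * gauge_mean a * c.
Proof.
move=> Bb Bc; apply: (tends_uniq (gauge_meanP _)).
apply: (tends_near (k := 0)) (tends_MM b c (gauge_meanP a)) => n _.
by rewrite avg_bimodule // => i x; rewrite !gaugeM (gauge_B i Bb) (gauge_B i Bc).
Qed.

Lemma gauge_mean_B b : B b -> gauge_mean b = b.
Proof.
move=> Bb; apply: (tends_uniq (gauge_meanP b)).
apply: (tends_near (k := 0)) (tends_const b) => n _.
by rewrite avg_fixed // => i _; apply: gauge_B.
Qed.

Lemma gauge_mean_word p q b c : B b -> B c ->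
  gauge_mean (b * s ^+ p * star s ^+ q * c) =
  if p == q then b * s ^+ p * star s ^+ q * c else 0.
Proof.
move=> Bb Bc; set x := _ * c; apply: (tends_uniq (gauge_meanP x)).
case: eqP => [pq|/dyadic_root_balance - /(_ R) [N hN]].
  apply: (tends_near (k := 0)) (tends_const x) => n _.
  rewrite avg_fixed // => i _; rewrite gauge_word // pq -exprMn.
  by rewrite dyadic_root_unit expr1n scale1r /x pq.
(* Averages of index above [N] act first and only rescale the word; stage [N] then multiplies it by
   (1 - 1)/2. *)
have scal m k : exists z : R[i], avg gauge m k x = z *: x.
  elim: k m => [|k IH] m /=; first by exists 1; rewrite scale1r.
  have [z ->] := IH m.+1; rewrite /half_sum gaugeZ gauge_word // -/x scalerA -scalerDl scalerA.
  by eexists.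
apply: (tends_near (k := N.+1)) (tends_const 0) => n Nn.
have -> : n = (N + 1 + (n - N.+1))%N by rewrite addn1 subnKC.
rewrite !avg_addn !add0n /=; have [z ->] := scal (N + 1)%N (n - N.+1)%N.
rewrite /half_sum gaugeZ gauge_word // -/x hN scaleN1r scalerN subrr scaler0.
by rewrite -[X in avg _ _ _ X](scale0r 0) avgZ // scale0r.
Qed.

(* On the range of [gauge_mean], which is fixed by the gauge action, averaging
   over conjugation by all powers of u retains the C^*(u)-part. *)
Definition ad i x : A := u ^+ (2 ^ i)%N * x * star (u ^+ (2 ^ i)%N).

Lemma uX_unitary k : star (u ^+ k) * u ^+ k = 1 /\ u ^+ k * star (u ^+ k) = 1.
Proof.
elim: k => [|k [IH1 IH2]]; first by rewrite expr0 star1 mulr1.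
split; first by rewrite exprS starM -mulrA (u_starK rel).
by rewrite exprSr starM -mulrA (u_starKV rel).
Qed.

Lemma cnorm_uX k : cnorm (u ^+ k) <= 1.
Proof. by have [h _] := uX_unitary k; apply: cnorm_isometry. Qed.

Lemma adD i a b : ad i (a + b) = ad i a + ad i b.
Proof. by rewrite /ad mulrDr mulrDl. Qed.

Lemma adZ i (z : R[i]) a : ad i (z *: a) = z *: ad i a.
Proof. by rewrite /ad -scalerAr -scalerAl. Qed.

Lemma ad_le i a : cnorm (ad i a) <= cnorm a.
Proof. by apply: cnorm_contract; rewrite ?cnorm_star cnorm_uX. Qed.

Lemma ad_pos i a : pos a -> pos (ad i a).
Proof.
move=> [k ks ->]; have [h _] := uX_unitary (2 ^ i); exists (ad i k).
  by rewrite /self_adjoint /ad !starM starK ks mulrA.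
by rewrite /ad -!mulrA (mulrA (star _) (u ^+ _)) h mul1r.
Qed.

Lemma ad_bimodule i b x c : B b -> B c -> ad i (b * x * c) = b * ad i x * c.
Proof.
move=> Bb Bc; have BU : B (u ^+ (2 ^ i)%N) by apply: BX rel _ _ (@Bu _ _ u).
rewrite /ad !mulrA (B_comm rel BU Bb) -!mulrA; do 3 congr (_ * _).
by rewrite (B_comm rel Bc (Bstar BU)).
Qed.

Lemma s_uX k : s * u ^+ k = u ^+ (2 * k)%N * s.
Proof.
elim: k => [|k IH]; first by rewrite muln0 !expr0 mul1r mulr1.
by rewrite exprSr mulrA IH -mulrA (s_u rel) mulrA -exprD mulnS addnC.
Qed.

Lemma sX_uX p k : s ^+ p * u ^+ k = u ^+ (2 ^ p * k)%N * s ^+ p.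
Proof.
elim: p => [|p IH]; first by rewrite mul1n expr0 mul1r mulr1.
by rewrite exprS -mulrA IH mulrA s_uX mulnA -expnS -mulrA.
Qed.

(** Read with [x] = 1, this shows that late conjugations fix s^p s^*^p; with [x] = s s^* and [k] =
    1, it gives the other half of s^p s^*^p. *)
Lemma range_proj_sandwich p k x :
  u ^+ (2 ^ p * k)%N * (s ^+ p * x * star s ^+ p) * star (u ^+ (2 ^ p * k)%N) =
  s ^+ p * (u ^+ k * x * star (u ^+ k)) * star s ^+ p.
Proof.
have e : star s ^+ p * star (u ^+ (2 ^ p * k)%N) = star (u ^+ k) * star s ^+ p.
  by rewrite -starX -!starM sX_uX.
by rewrite -!mulrA e !mulrA -sX_uX.
Qed.

Lemma ad_range_proj p i : (p <= i)%N -> ad i (s ^+ p * star s ^+ p) = s ^+ p * star s ^+ p.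
Proof.
move=> pi; have [_ h] := uX_unitary (2 ^ (i - p)).
have := range_proj_sandwich p (2 ^ (i - p)) 1.
by rewrite -expnD subnKC // !mulr1 h mulr1.
Qed.

(** The range of s^(p+1) and its translate by u^(2^p) make up the range of s^p. In all, 2^p
    translates with sum 1 are averaged. *)
Lemma avg_range_proj p : avg ad 0 p (s ^+ p * star s ^+ p) = (2^-1 ^+ p) *:: 1.
Proof.
elim: p => [|p IH]; first by rewrite /= !expr0 mulr1 scale1r.
rewrite -[X in avg _ _ X]addn1 avg_addn add0n /= /half_sum.
have -> : s ^+ p.+1 * star s ^+ p.+1 + ad p (s ^+ p.+1 * star s ^+ p.+1) =
    s ^+ p * star s ^+ p.
  have e : s ^+ p.+1 * star s ^+ p.+1 = s ^+ p * (s * star s) * star s ^+ p.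
    by rewrite exprSr exprS !mulrA.
  have := range_proj_sandwich p 1 (s * star s); rewrite muln1 -e -/(ad p _) => ->.
  rewrite e -mulrDl -mulrDr expr1 -[u * _ * _]mulrA -!mulrA.
  have := range_sum rel; rewrite -!mulrA => ->.
  by rewrite mul1r.
rewrite avgZ; [|exact: adZ]; rewrite IH scalerA -rmorphM -exprS //.
Qed.

Lemma slow_ad_word p b c : B b -> B c -> slow ad (b * (s ^+ p * star s ^+ p) * c).
Proof.
move=> Bb Bc e e0; exists p => m k pm.
rewrite avg_bimodule => [|i x]; last exact: ad_bimodule.
rewrite avg_fixed ?subrr ?cnorm0 ?ltW // => i mi.
by apply: ad_range_proj; apply: leq_trans mi.
Qed.

Lemma approx_closed_slow_ad : approx_closed [set a | slow ad a].
Proof. by apply: approx_closed_slow; [apply: adD | apply: adZ | apply: ad_le]. Qed.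

Lemma gauge_meanB a b : gauge_mean (a - b) = gauge_mean a - gauge_mean b.
Proof. by rewrite gauge_meanD -scaleN1r gauge_meanZ scaleN1r. Qed.

(** Words with p <> q vanish under [gauge_mean], so closed additive properties of its values can be
    tested on balanced words. *)
Lemma gauge_mean_ind (P : set A) : approx_closed P ->
  (forall a b, P a -> P b -> P (a + b)) ->
  (forall p b c, B b -> B c -> P (b * (s ^+ p * star s ^+ p) * c)) ->
  forall a, P (gauge_mean a).
Proof.
move=> Pcl PD Pw a; apply: Pcl => e e0.
have [x hx ax] := word_span_dense rel gen a e0.
exists (gauge_mean x); last by rewrite -gauge_meanB (le_trans (gauge_mean_le _)).
elim: hx {ax} => [p q b c Bb Bc|{}x y _ hx _ hy]; last by rewrite gauge_meanD; apply: PD.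
rewrite gauge_mean_word //; case: eqP => [->|_]; first by rewrite -(mulrA b); apply: Pw.
by have := Pw 0%N 0 0 (@B0 _ _ u) (@B0 _ _ u); rewrite mulr0.
Qed.

Lemma ad_lim_ex a : exists l, tends (fun n => avg ad 0 n (gauge_mean a)) l.
Proof.
apply: slow_lim; [exact: adD | exact: adZ | exact: ad_le |].
apply: (gauge_mean_ind approx_closed_slow_ad) => [x y|]; first by apply: slowD; apply: adD.
exact: slow_ad_word.
Qed.

Definition expectation : A -> A := projT1 (choice ad_lim_ex).

Lemma expectationP a : tends (fun n => avg ad 0 n (gauge_mean a)) (expectation a).
Proof. exact: (projT2 (choice ad_lim_ex)). Qed.

Lemma expectationD a b : expectation (a + b) = expectation a + expectation b.
Proof.
apply: (tends_uniq (expectationP (a + b))).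
apply: (tends_near (k := 0)) (tendsD (expectationP a) (expectationP b)) => n _.
by rewrite gauge_meanD avgD //; apply: adD.
Qed.

Lemma expectationZ (z : R[i]) a : expectation (z *: a) = z *: expectation a.
Proof.
apply: (tends_uniq (expectationP (z *: a))).
apply: (tends_near (k := 0)) (tendsZ z (expectationP a)) => n _.
by rewrite gauge_meanZ avgZ //; apply: adZ.
Qed.

Lemma expectation_le a : cnorm (expectation a) <= cnorm a.
Proof.
apply: tends_cnorm_le (expectationP a) => n.
by apply: le_trans (gauge_mean_le a); apply: avg_le; apply: ad_le.
Qed.

Lemma expectation_pos a : pos a -> pos (expectation a).
Proof.
move=> pa; apply: (approx_lim (@approx_closed_pos _ A) _ (expectationP a)) => n /=.
by apply: avg_pos; [apply: ad_pos | apply: gauge_mean_pos].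
Qed.

Lemma expectation_faithful a : pos a -> expectation a = 0 -> a = 0.
Proof.
move=> pa a0; apply: gauge_mean_faithful => //.
apply: (@avg_lim_faithful _ _ ad ad_pos).
- apply: (gauge_mean_ind approx_closed_slow_ad) => [x y|]; first by apply: slowD; apply: adD.
  exact: slow_ad_word.
- exact: gauge_mean_pos.
by rewrite -a0; apply: expectationP.
Qed.

Lemma expectation_bimodule b a c : B b -> B c -> expectation (b * a * c) = b * expectation a * c.
Proof.
move=> Bb Bc; apply: (tends_uniq (expectationP _)).
apply: (tends_near (k := 0)) (tends_MM b c (expectationP a)) => n _.
by rewrite gauge_mean_bimodule // avg_bimodule // => i x; apply: ad_bimodule.
Qed.

Lemma expectation_B b : B b -> expectation b = b.
Proof.
move=> Bb; apply: (tends_uniq (expectationP b)).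
apply: (tends_near (k := 0)) (tends_const b) => n _.
rewrite gauge_mean_B // avg_fixed // => i _.
have := ad_bimodule i 1 Bb (B1 rel); rewrite !mulr1 => ->.
by rewrite /ad mulr1 (uX_unitary _).2 mulr1.
Qed.

(** [expectation] sees [a] only through [gauge_mean a], and on a balanced word it is 2^-p b c. *)
Lemma expectation_in_B a : B (expectation a).
Proof.
have E0 x : gauge_mean (gauge_mean x) = gauge_mean x.
  apply: (gauge_mean_ind (P := [set y | gauge_mean y = y])) => /=.
  - move=> y hy; apply/eqP; rewrite -subr_eq0; apply/eqP; apply: cnorm_small => e e0.
    have [|z /= hz yz] := hy (e / 2); first by rewrite divr_gt0.
    have -> : gauge_mean y - y = gauge_mean (y - z) + (z - y).
      by rewrite gauge_meanB hz addrA subrK.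
    rewrite (le_trans (cnormD _ _)) //; have := gauge_mean_le (y - z).
    by rewrite (cnorm_distC y); lra.
  - by move=> y z hy hz; rewrite gauge_meanD hy hz.
  - by move=> p b c Bb Bc; rewrite mulrA gauge_mean_word // eqxx.
have -> : expectation a = expectation (gauge_mean a).
  apply: (tends_uniq (expectationP a)).
  by apply: (tends_near (k := 0)) (expectationP (gauge_mean a)) => n _; rewrite E0.
apply: (gauge_mean_ind (P := [set y | B (expectation y)])).
- apply: (@approx_closed_lip _ _ _ 1) (@B_closed _ _ u) => x y.
  by rewrite -[- _]scaleN1r -expectationZ -expectationD scaleN1r mul1r expectation_le.
- by move=> x y hx hy; rewrite /= expectationD; apply: BD.
move=> p b c Bb Bc /=; rewrite expectation_bimodule //; apply: BM => //; apply: BM => //.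
have -> : expectation (s ^+ p * star s ^+ p) = (2^-1 ^+ p) *:: 1; last exact: BZ (B1 rel).
apply: (tends_uniq (expectationP _)).
apply: (tends_near (k := p)) (tends_const _) => n pn.
have := gauge_mean_word p p (B1 rel) (B1 rel); rewrite eqxx mul1r mulr1 => ->.
rewrite -(subnKC pn) avg_addn add0n [avg ad p _ _]avg_fixed ?avg_range_proj // => i.
exact: ad_range_proj.
Qed.

End Expectation.

(** * Maximality *)

Section MaximalAbelian.
Variables (R : realType) (A : cstarAlgType R) (u s : A).
Hypotheses (rel : Q2_relations u s) (gen : cstar_gen [set u; s] = setT).
Implicit Types (a b c x y : A).

Let B : set A := cstar_gen [set u].

Variable E : A -> A.
Hypotheses (ED : forall a b, E (a + b) = E a + E b)
  (EZ : forall (z : R[i]) a, E (z *: a) = z *: E a)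
  (E_le : forall a, cnorm (E a) <= cnorm a)
  (EM : forall a b c, B b -> B c -> E (b * a * c) = b * E a * c)
  (E_B : forall a, B (E a)) (E_id : forall b, B b -> E b = b)
  (E_faithful : forall a, E (star a * a) = 0 -> a = 0).

Lemma E_ad i x : E (ad u i x) = E x.
Proof.
have BU : B (u ^+ (2 ^ i)%N) by apply: BX rel _ _ (@Bu _ _ u).
rewrite /ad EM ?(B_comm rel BU (E_B x)) //; last exact: Bstar.
by rewrite -mulrA (uX_unitary rel _).2 mulr1.
Qed.

(** For x = y s^p s^*^q, both u^(2^p) x and x u^(2^q) equal y s^p u s^*^q. As [B] is commutative,
    u^(2^p) and u^(2^q) agree on [E x], and [B_torsion_free] applies with k = 2^q - 2^p. *)
Lemma E_unbalanced y p q : (forall b, B b -> b * y = y * b) -> (p < q)%N ->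
  E (y * (s ^+ p * star s ^+ q)) = 0 /\ E (y * (s ^+ q * star s ^+ p)) = 0.
Proof.
move=> yB pq; pose U k : A := u ^+ (2 ^ k)%N.
have BU k : B (U k) by apply: BX rel _ _ (@Bu _ _ u).
have Us k : U k * s ^+ k = s ^+ k * u by have := sX_uX rel k 1; rewrite muln1 expr1.
have sU k : star s ^+ k * U k = u * star s ^+ k.
  have Us' : star (U k) * s ^+ k = s ^+ k * star u.
    rewrite -[in LHS](mulr1 (s ^+ k)) -(unitaryKV rel) (mulrA _ u) -Us !mulrA.
    by rewrite (uX_unitary rel _).1 mul1r.
  by have := congr1 star Us'; rewrite !starM !starX !starK.
have comm k l : U k * E (y * (s ^+ k * star s ^+ l)) = U l * E (y * (s ^+ k * star s ^+ l)).
  have e : U k * (y * (s ^+ k * star s ^+ l)) = y * (s ^+ k * star s ^+ l) * U l.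
    by rewrite mulrA yB // -mulrA mulrA -!mulrA sU (mulrA (U k)) Us !mulrA.
  set x := y * _ in e *; rewrite [RHS](B_comm rel (BU l) (E_B _)).
  have := EM x (B1 rel) (BU l); rewrite !mul1r -e => <-.
  by have := EM x (BU k) (B1 rel); rewrite !mulr1.
have d0 : (0 < 2 ^ q - 2 ^ p)%N by rewrite subn_gt0 ltn_exp2l.
have tors b : B b -> U p * b = U q * b -> b = 0.
  move=> Bb h; apply: (B_torsion_free rel d0 Bb).
  have := congr1 (fun x => star (U p) * x) h.
  rewrite !mulrA (uX_unitary rel _).1 mul1r => e; rewrite [RHS]e.
  have -> : U q = U p * u ^+ (2 ^ q - 2 ^ p) by rewrite /U -exprD subnKC // leq_exp2l // ltnW.
  by rewrite mulrA (uX_unitary rel _).1 mul1r.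
split; first by apply: tors; [apply: E_B | apply: comm].
by apply: tors; [apply: E_B | apply/esym/comm].
Qed.

Lemma E_orthogonal y x : (forall b, B b -> b * y = y * b) -> E y = 0 -> E (y * x) = 0.
Proof.
move=> yB y0.
have lip a c : cnorm (E (y * a) - E (y * c)) <= cnorm y * cnorm (a - c).
  rewrite -scaleN1r -EZ -ED scaleN1r -mulrBr (le_trans (E_le _)) //; exact: cnormM.
have cl : approx_closed [set a | E (y * a) = 0].
  apply: (@approx_closed_lip _ _ _ _ [set 0] lip) => a ha /=.
  apply: cnorm_small => e /ha [b -> /=]; by rewrite sub0r cnormN.
apply: cl => e e0; have [z hz xz] := word_span_dense rel gen x e0; exists z => //=.
elim: hz {xz} => [p q b c Bb Bc|{}x z' _ hx _ hz]; last by rewrite mulrDr ED hx hz addr0.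
have -> : y * (b * s ^+ p * star s ^+ q * c) = b * (y * (s ^+ p * star s ^+ q)) * c.
  by rewrite !mulrA yB.
rewrite EM //; suff -> : E (y * (s ^+ p * star s ^+ q)) = 0 by rewrite mulr0 mul0r.
have [pq|qp|->] := ltngtP p q.
- by have [] := E_unbalanced yB pq.
- by have [] := E_unbalanced yB qp.
(* [y] commutes with powers of [u] and [E] is invariant under [ad], so averages may be inserted
   behind [y]. *)
have Ead n k z'' : E (y * avg (ad u) n k z'') = E (y * z'').
  elim: k n => //= k IH n; rewrite /half_sum -scalerAr mulrDr EZ ED.
  set t := avg _ _ _ _.
  have -> : y * ad u n t = ad u n (y * t).
    rewrite /ad !mulrA yB //; exact: BX rel _ _ (@Bu _ _ u).
  by rewrite E_ad scalerDr scale_halfD /t IH.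
rewrite -(Ead 0%N q) avg_range_proj // -scalerAr mulr1 EZ y0 scaler0 //.
Qed.

Lemma commutant_in_B x : (forall b, B b -> b * x = x * b) -> B x.
Proof.
move=> xB; pose y := x - E x.
have yB b : B b -> b * y = y * b.
  by move=> Bb; rewrite mulrBr mulrBl xB // (B_comm rel Bb (E_B x)).
have y0 : E y = 0 by rewrite /y -scaleN1r ED EZ (E_id (E_B x)) scaleN1r subrr.
have : star y = 0 by apply: E_faithful; rewrite starK; apply: E_orthogonal.
move=> /(congr1 star); rewrite starK star0 => /eqP; rewrite subr_eq0 => /eqP ->.
exact: E_B.
Qed.

End MaximalAbelian.

Theorem proposition6p1 (R : realType) (Q2 : cstarAlgType R) (u s2 : Q2)
  (hQ2 : is_Q2 u s2) : cartan_subalgebra (cstar_gen (set1 u)).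
Proof.
have [rel gen univ] := hQ2; set B := cstar_gen _.
have B1' : B 1 := B1 rel.
have abel : abelian_cstar_subalgebra B.
  by split; [apply: cstar_gen_subalgebra | move=> a b; apply: (B_comm rel)].
have gauge_rel n : Q2_relations u (dyadic_root R n *: s2).
  have [uU sI su rs] := rel; have cc := dyadic_root_unit R n.
  split => //.
  - by rewrite /cstar_isometry starZ -scalerAl -scalerAr scalerA mulrC cc scale1r.
  - by rewrite -scalerAl -scalerAr su.
  - by rewrite starZ -!scalerAr -!scalerAl !scalerA ![_^* * _]mulrC cc !scale1r.
have gauge_ex n : exists f : {lrmorphism Q2 -> Q2},
  [/\ forall a, f (star a) = star (f a), f u = u & f s2 = dyadic_root R n *: s2].
  exact: univ (gauge_rel n).
pose gauge n : Q2 -> Q2 := projT1 (choice gauge_ex) n.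
have gP n := projT2 (choice gauge_ex) n.
have gD n a b : gauge n (a + b) = gauge n a + gauge n b by apply: rmorphD.
have gZ n (z : R[i]) a : gauge n (z *: a) = z *: gauge n a by apply: linearZ.
have gM n a b : gauge n (a * b) = gauge n a * gauge n b by apply: rmorphM.
have gS n a : gauge n (star a) = star (gauge n a) by case: (gP n) => h _ _; apply: h.
have gle n a : cnorm (gauge n a) <= cnorm a by apply: cnorm_morph_le; apply: gS.
have gu n : gauge n u = u by case: (gP n).
have gs n : gauge n s2 = dyadic_root R n *: s2 by case: (gP n).
pose E := expectation rel gen gD gZ gM gS gle gu gs.
have ED a b : E (a + b) = E a + E b by apply: expectationD.
have EZ (z : R[i]) a : E (z *: a) = z *: E a by apply: expectationZ.
have Ele a : cnorm (E a) <= cnorm a by apply: expectation_le.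
have EM a b c : B b -> B c -> E (b * a * c) = b * E a * c by apply: expectation_bimodule.
have EB a : B (E a) by apply: expectation_in_B.
have Eid b : B b -> E b = b by apply: expectation_B.
have Efaith a : E (star a * a) = 0 -> a = 0.
  by move=> h; apply: starM_eq0; apply: (expectation_faithful (pos_starM a) h).
split=> //.
(* [B] contains the unit, so a one-point net suffices. *)
- exists unit, (fun _ _ => True), (fun=> 1); split; last by [].
  have cvg1 (x : Q2) : cstar_cvg (net_filter (fun _ _ : unit => True)) (fun=> x) x.
    rewrite /cstar_cvg subrr cnorm0 => P hP; exists tt => // j _.
    exact: nbhs_singleton hP.
  split.
  + by split=> // i j; exists tt.
  + move=> _; split; last exact: cnorm1_le1.
    by exists 1; rewrite star1 mulr1.
  + by move=> _ _ _; exists 0; rewrite subrr mulr0.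
  + by move=> a; rewrite mul1r mulr1.
- split=> // D [Dsub Dcomm] BD; apply/seteqP; split=> // x Dx.
  apply: (commutant_in_B rel gen ED EZ Ele EM EB Eid Efaith) => b Bb.
  by apply: Dcomm => //; apply: BD.
- exact: B_regular rel gen.
have Elin : linear E by move=> z a b; rewrite ED EZ.
pose EL : {linear Q2 -> Q2} := HB.pack E (GRing.isLinear.Build _ _ _ _ E Elin).
exists EL; split; last exact: Efaith.
split; first by split; [apply: EB | apply: Eid].
- exact: Ele.
- by move=> a /cstar_positiveE pa; apply/cstar_positiveE; apply: expectation_pos.
- by move=> b a c; apply: EM.
Qed.
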